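(* Let $G$ and $H$ be infinite finitely generated groups. Then for every real $p \ge 1$, $$\alpha_p^*(G \wr H) \;\geq\; \max\left\{\frac{1}{p},\frac{1}{2}\right\} \cdot \min\left\{\alpha_1^*(G),\ \frac{\alpha_1^*(H)}{1 + \alpha_1^*(H)}\right\}.$$
   Context: Wreath product: $G \wr H$ is the group of all pairs $(f,x)$ where $x \in H$ and $f : H \to G$ is finitely supported (i.e. $f(z)=e_G$ for all but finitely many $z\in H$), with product $(f,x)\cdot(g,y) = (z \mapsto f(z)g(x^{-1}z),\, xy)$. If $S$ and $T$ are finite generating sets of $G$ and $H$, then $G\wr H$ is generated by the finite set $\{(\mathbf{e},t): t \in T\} \cup \{(\delta_s,e_H) : s \in S\}$, where $\mathbf{e}$ is the function constantly equal to $e_G$ and $\delta_s$ is the function with value $s$ at $e_H$ and $e_G$ elsewhere. Compression exponent: $L_p$ denotes $L_p([0,1])$. For a finitely generated group $\Gamma$ with (left-invariant) word metric $d$ with respect to a finite generating set, $\alpha_p^*(\Gamma)$ is the supremum of all $\alpha \ge 0$ for which there exist a Lipschitz map $f : \Gamma \to L_p$ and a constant $c>0$ such that $\|f(x)-f(y)\|_p \ge c\, d(x,y)^\alpha$ for all $x,y\in\Gamma$. This does not depend on the choice of finite generating set. *)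

(* Defs.v *)
From HB Require Import structures.
From mathcomp Require Import all_boot all_order all_algebra finmap.
From mathcomp Require Import all_classical all_reals all_analysis.

Set Implicit Arguments.
Unset Strict Implicit.
Unset Printing Implicit Defensive.
Import Order.TTheory GRing.Theory Num.Theory.

Local Open Scope fset_scope.
Local Open Scope group_scope.

Definition word_in (Gam : groupType) (S : {fset Gam}) (w : seq Gam) : bool :=
  all (fun s => (s \in S) || (s^-1 \in S)) w.

Definition generates (Gam : groupType) (S : {fset Gam}) : Prop :=
  forall x : Gam, exists2 w : seq Gam, word_in S w & \prod_(s <- w) s = x.

(* A finite generating set; a group is finitely generated iff this type is
   inhabited. *)
Record genset (Gam : groupType) := Genset {
  gens :> {fset Gam};
  gensP : generates gens
}.

Section WordMetric.
Variables (Gam : groupType) (S : genset Gam).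

Definition has_word (x : Gam) (n : nat) : Prop :=
  exists w : seq Gam, [/\ size w = n, word_in S w & \prod_(s <- w) s = x].

Lemma has_word_ex (x : Gam) : exists n, `[< has_word x n >].
Proof.
by have [w Sw wx] := gensP S x; exists (size w); apply/asboolP; exists w.
Qed.

Definition word_length (x : Gam) : nat := ex_minn (has_word_ex x).

Definition word_dist (x y : Gam) : nat := word_length (x^-1 * y).

End WordMetric.

Section WreathProduct.
Variables G H : groupType.

(* The finmap type {fsfun H -> G with 1} consists of the functions H -> G that
   take the value 1 outside a finite set. *)
Definition wreath : Type := ({fsfun H -> G with 1} * H)%type.

HB.instance Definition _ := Choice.on wreath.

Implicit Types (a b : wreath) (f g : {fsfun H -> G with 1}).

Definition wreath_one : wreath := ([fsfun for fun=> 1], 1).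

(* The explicit finite sets below contain the support of the function; see
   wreath_mulE and wreath_invE for the values at an arbitrary point. *)
Definition wreath_mul a b : wreath :=
  ([fsfun z in finsupp a.1 `|` [fset a.2 * z | z in finsupp b.1]
      => a.1 z * b.1 (a.2^-1 * z)],
   a.2 * b.2).

Definition wreath_inv a : wreath :=
  ([fsfun z in [fset a.2^-1 * z | z in finsupp a.1] => (a.1 (a.2 * z))^-1],
   a.2^-1).

Lemma wreath_mulE a b z :
  (wreath_mul a b).1 z = a.1 z * b.1 (a.2^-1 * z).
Proof.
rewrite fsfunE; case: ifPn => //; rewrite in_fsetU negb_or => /andP[za zb].
rewrite (fsfun_dflt za) fsfun_dflt ?mulg1//.
by apply: contra zb => zb; apply/imfsetP; exists (a.2^-1 * z) => //; rewrite mulVKg.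
Qed.

Lemma wreath_invE a z : (wreath_inv a).1 z = (a.1 (a.2 * z))^-1.
Proof.
rewrite fsfunE; case: ifPn => // za; rewrite fsfun_dflt ?invg1//.
by apply: contra za => za; apply/imfsetP; exists (a.2 * z) => //; rewrite mulKg.
Qed.

Lemma wreath_eqP a b : a.1 =1 b.1 -> a.2 = b.2 -> a = b.
Proof. by case: a b => [f x] [g y] /= /fsfunP -> ->. Qed.

Lemma wreath_mulA : associative wreath_mul.
Proof.
move=> a b c; apply: wreath_eqP => [z|]; last exact: mulgA.
by rewrite !wreath_mulE /= invgM !mulgA.
Qed.

Lemma wreath_mul1 : left_id wreath_one wreath_mul.
Proof.
move=> a; apply: wreath_eqP => [z|]; last exact: mul1g.
by rewrite wreath_mulE /= fsfunE invg1 !mul1g.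
Qed.

Lemma wreath_1mul : right_id wreath_one wreath_mul.
Proof.
move=> a; apply: wreath_eqP => [z|]; last exact: mulg1.
by rewrite wreath_mulE /= fsfunE mulg1.
Qed.

Lemma wreath_mulV : left_inverse wreath_one wreath_inv wreath_mul.
Proof.
move=> a; apply: wreath_eqP => [z|]; last exact: mulVg.
by rewrite wreath_mulE wreath_invE /= fsfunE invgK mulVg.
Qed.

Lemma wreath_Vmul : right_inverse wreath_one wreath_inv wreath_mul.
Proof.
move=> a; apply: wreath_eqP => [z|]; last exact: mulgV.
by rewrite wreath_mulE wreath_invE /= fsfunE mulVKg mulgV.
Qed.

HB.instance Definition _ := isGroup.Build wreath
  wreath_mulA wreath_mul1 wreath_1mul wreath_mulV wreath_Vmul.

Definition wreath_delta (s : G) : {fsfun H -> G with 1} :=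
  [fsfun z in [fset (1 : H)] => s].

Definition wreath_base (t : H) : wreath := ([fsfun for fun=> 1], t).

Definition wreath_lamp (s : G) : wreath := (wreath_delta s, 1).

Definition wreath_gens (S : {fset G}) (T : {fset H}) : {fset wreath} :=
  [fset wreath_base t | t in T] `|` [fset wreath_lamp s | s in S].

Lemma wreath_deltaE (s : G) (z : H) :
  wreath_delta s z = if z == 1 then s else 1.
Proof. by rewrite fsfunE inE. Qed.

Lemma wreath_baseM (x y : H) : wreath_base (x * y) = wreath_base x * wreath_base y.
Proof.
by apply: wreath_eqP => // z; rewrite wreath_mulE /= !fsfunE mulg1.
Qed.

Lemma wreath_lampM (s t : G) : wreath_lamp (s * t) = wreath_lamp s * wreath_lamp t.
Proof.
apply: wreath_eqP => [z|]; last by rewrite /= mulg1.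
by rewrite wreath_mulE /= invg1 mul1g !wreath_deltaE; case: ifP; rewrite ?mulg1.
Qed.

Lemma wreath_base1 : wreath_base 1 = 1. Proof. by []. Qed.

Lemma wreath_lamp1 : wreath_lamp 1 = 1.
Proof.
by apply: wreath_eqP => // z; rewrite /= wreath_deltaE fsfunE; case: ifP.
Qed.

Lemma wreath_baseV (x : H) : wreath_base x^-1 = (wreath_base x)^-1.
Proof.
by apply: (mulgI (wreath_base x)); rewrite -wreath_baseM !mulgV.
Qed.

Lemma wreath_lampV (s : G) : wreath_lamp s^-1 = (wreath_lamp s)^-1.
Proof.
by apply: (mulgI (wreath_lamp s)); rewrite -wreath_lampM !mulgV wreath_lamp1.
Qed.

Lemma wreath_generates (S : genset G) (T : genset H) :
  generates (wreath_gens S T).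
Proof.
pose P a := exists2 w, word_in (wreath_gens S T) w & \prod_(s <- w) s = a.
have PM a b : P a -> P b -> P (a * b).
  move=> [v Sv <-] [w Sw <-]; exists (v ++ w); last by rewrite big_cat.
  by rewrite /word_in all_cat; apply/andP.
have Pbase x : P (wreath_base x).
  have [w Tw <-] := gensP T x; exists [seq wreath_base t | t <- w].
    apply/allP => _ /mapP[t /(allP Tw) Tt ->]; rewrite -wreath_baseV !in_fsetU.
    by case/orP: Tt => Tt; apply/orP; [left|right]; rewrite in_imfset.
  by rewrite big_map (big_morph wreath_base wreath_baseM wreath_base1).
have Plamp s : P (wreath_lamp s).
  have [w Sw <-] := gensP S s; exists [seq wreath_lamp t | t <- w].
    apply/allP => _ /mapP[t /(allP Sw) St ->]; rewrite -wreath_lampV !in_fsetU.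
    case/orP: St => St; apply/orP; [left|right]; apply/orP; right;
      exact: in_imfset.
  by rewrite big_map (big_morph wreath_lamp wreath_lampM wreath_lamp1).
suff Pf f : P (f, 1).
  move=> [f x]; have -> : (f, x) = ((f, 1) : wreath) * wreath_base x.
    apply: wreath_eqP => [z|]; last by rewrite /= mul1g.
    by rewrite wreath_mulE /= fsfunE mulg1.
  exact: PM.
have [n] := ubnP #|` finsupp f|; elim: n => // n IHn in f *.
have [f0 _|[z fz]] := fset_0Vmem (finsupp f).
  suff -> : (f, 1) = wreath_base 1 by [].
  by apply: wreath_eqP => // z; rewrite /= fsfunE fsfun_dflt // f0.
rewrite ltnS (cardfsD1 z) fz add1n => fn.
pose f' : {fsfun H -> G with 1} := [fsfun w in finsupp f `\ z => f w].
have -> : (f, 1) = (wreath_base z * wreath_lamp (f z) * wreath_base z^-1)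
    * ((f', 1) : wreath).
  apply: wreath_eqP => [w|]; last by rewrite /= !mulg1 mulgV.
  rewrite 3!wreath_mulE /= wreath_deltaE !fsfunE !mulg1 mul1g mulgV invg1 mul1g.
  rewrite in_fsetD1 -(inj_eq (mulgI z)) mulVKg mulg1.
  have [->|wz] := eqVneq w z; first by rewrite mulg1.
  by rewrite mul1g; case: ifPn => // /fsfun_dflt ->.
apply: (PM); first by apply: (PM) => //; exact: PM.
apply: IHn; apply: leq_ltn_trans fn; apply: fsubset_leq_card.
by apply/fsubsetP => w; rewrite mem_finsupp fsfunE; case: ifP => //; rewrite eqxx.
Qed.

Definition wreath_genset (S : genset G) (T : genset H) : genset wreath :=
  Genset (wreath_generates S T).

End WreathProduct.

Local Close Scope group_scope.
Local Close Scope fset_scope.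
Local Open Scope classical_set_scope.
Local Open Scope ring_scope.

Section Compression.
Variable R : realType.

(* Lebesgue measure on [0, 1], as a measure on the line concentrated there *)
Definition lebesgue01 : {measure set (measurableTypeR R) -> \bar R} :=
  mrestr lebesgue_measure (measurable_itv `[0 : R, 1 : R]).

Variables (p : R) (p1 : 1 <= p).

Definition Lp01 : Type := LspaceType lebesgue01 (p1 : (1 <= p%:E)%E).

(* u and v are classes modulo equality a.e.; they coerce to functions through a
   representative, on whose choice the norm does not depend. *)
Definition Lp01_dist (u v : Lp01) : \bar R :=
  'N[lebesgue01]_(p%:E)[EFin \o (u \- v)%R]%E.

Section Group.
Variables (Gam : groupType) (S : genset Gam).

Definition Lp_lipschitz (f : Gam -> Lp01) : Prop :=
  exists L : R, forall x y : Gam,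
    (Lp01_dist (f x) (f y) <= (L * (word_dist S x y)%:R)%:E)%E.

(* At x = y the bound is trivial if 0 < alpha; it is not imposed there because
   powR sets 0 `^ 0 = 1, whereas alpha = 0 should be admissible. *)
Definition compresses (alpha : R) (f : Gam -> Lp01) : Prop :=
  exists2 c : R, 0 < c & forall x y : Gam, x != y ->
    ((c * (word_dist S x y)%:R `^ alpha)%:E <= Lp01_dist (f x) (f y))%E.

(* The supremum is taken in R: for an infinite group the set contains 0 and is
   bounded by 1. *)
Definition compression_exponent : R :=
  sup [set alpha : R | 0 <= alpha /\
        exists f : Gam -> Lp01, Lp_lipschitz f /\ compresses alpha f].

End Group.
End Compression.

(* Main.v *)
From HB Require Import structures.
Require Import Defs.
From mathcomp Require Import all_boot all_order all_algebra finmap.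
From mathcomp Require Import all_classical all_reals all_analysis.
From mathcomp Require Import measurable_realfun.
From mathcomp Require Import ring lra zify.
Set Implicit Arguments.
Unset Strict Implicit.
Unset Printing Implicit Defensive.
Import Order.TTheory GRing.Theory Num.Theory.
Import numFieldNormedType.Exports.
Local Open Scope classical_set_scope.
Local Open Scope ring_scope.

(** The theorem compares L_1 embeddings of G and H with L_p embeddings of the
    wreath product; the link is the notion of a cut metric. A family of
    measurable events E_j(x) in [0,1], indexed by a countable j and by the points
    x of a set, defines the pseudometric sum_j P(E_j(x) differs from E_j(y))
    ([cut_metric]). Rounding an L_1-valued map to integer values and slicing it
    into its superlevel sets turns it into such a family, at the price of a
    bounded additive error ([level_cut_metric]). Distinct points of a group are
    at word distance at least 1, so the error is absorbed by rescaling
    ([cut_metric_of_L1]).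

    A cut A of H yields cuts of the wreath product: for each of the two sides of
    A and each finitely supported configuration h of lamps on the other side,
    take the set of the (f, x) such that x lies on the first side and f agrees
    with h on the other one. At most two of them separate two given points.
    Moving the cursor from x to x' costs twice the cut metric of H between x and
    x', and changing the lamp at the cursor costs nothing. On the other hand, (f, x) and (g, y) are separated as soon as
    A separates two points of the set formed by x, y and the z where f and g
    differ. Thus, if the cut metric of H dominates d_H^beta, then the new cut
    metric dominates the beta-th power of the distance from x to the farthest of
    those points ([wreath_cut_ge_range]). Adding the cuts of G pulled back along
    the lamp at each z, the total metric s also dominates the sum of
    d_G(f(z), g(z))^alpha ([wreath_cut_ge_lamps]), hence the number of those z.
    A word for the displacement is obtained by visiting each such z in turn and
    returning to x; its length is of order
    sum_z (2 d_H(x, z) + d_G(f(z), g(z))) + d_H(x, y) ([wreath_word_dist]).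
    With at most s stops, each at distance at most s^(1/beta), the travel is
    O(s^(1 + 1/beta)), and the lamps cost at most s^(1/gamma). So the word
    distance is O(s^(1/gamma)) for gamma = min(alpha, beta/(1+beta))
    ([tour_bound], [wreath_cut_compression]).

    It remains to put the power max(1/p, 1/2) of a cut metric into L_p([0,1]).
    Since a difference of indicators has modulus 0 or 1, a cut metric is exactly
    the p-th power of an L_p distance, for every p ([embed_snowflake]); copies of
    [0,1] indexed by j are packed into the dyadic intervals ]2^-(j+1), 2^-j].
    For p = 2 this is a Hilbert space embedding; its Gram matrix has a Cholesky
    factorization with finitely supported rows because the space is countable,
    and replacing the coordinates by Rademacher functions carries it to L_p, with
    distances preserved up to constants by Khintchine's inequality
    ([embed_hilbert]). The exponent is 1/p in the first case and 1/2 in the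
    second. *)

(** * Realizing functions in L_p([0,1]) *)

Section LpRealization.
Variables (R : realType) (p : R) (p1 : 1 <= p).
Local Notation P := (lebesgue01 R).

Lemma measurable_Lp01 (u : Lp01 p1) : measurable_fun setT (u : R -> R).
Proof. exact: (@measurable_funP _ _ _ _ setT (repr (u : {mfun_ P, _ >-> _}))). Qed.

Lemma Lp01_distE (u v : Lp01 p1) :
  Lp01_dist u v = ((\int[P]_x (`|u x - v x| `^ p)%:E) `^ p^-1)%E.
Proof. by rewrite /Lp01_dist unlock. Qed.

Lemma measurable_norm_powR (g : R -> R) : measurable_fun setT g ->
  measurable_fun setT (fun x => (`|g x| `^ p)%:E).
Proof.
move=> mg; apply/measurable_EFinP.
apply: (measurableT_comp (measurable_powR p)).
exact: (measurableT_comp (@normr_measurable R setT)).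
Qed.

Lemma Lp01_of_fun (g : R -> R) : measurable_fun setT g ->
  (\int[P]_x (`|g x| `^ p)%:E < +oo)%E ->
  exists u : Lp01 p1, ae_eq P setT (u : R -> R) g.
Proof.
move=> mg fg.
pose G0 := isMeasurableFun.Build _ _ (measurableTypeR R) (measurableTypeR R) g mg.
pose G : {mfun measurableTypeR R >-> measurableTypeR R} := HB.pack g G0.
pose u := (\pi_(@aeEqMfun _ _ R _ _ P) G)%qT : {mfun_ P, measurableTypeR R >-> measurableTypeR R}.
have mu : measurable_fun setT (u : R -> R).
  exact: (@measurable_funP _ _ _ _ setT (repr u)).
have uG : ae_eq P setT (u : R -> R) g.
  have /eqP := (reprK u : _ = (\pi_(@aeEqMfun _ _ R _ _ P) G)%qT).
  by rewrite eqmodE => /asboolP; apply: filterS => x /= h.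
have fu : finite_norm P p%:E (u : R -> R).
  rewrite /finite_norm unlock; apply: poweR_lty.
  rewrite (@ge0_ae_eq_integral _ _ _ P setT _ (fun x => (`|g x| `^ p)%:E)) //.
  - exact: (measurable_norm_powR mu).
  - exact: measurable_norm_powR.
  - by move=> x _; rewrite poweR_ge0.
  - by apply: filterS uG => x /= /(_ Logic.I) -> _.
pose U0 := isFinLebesgue.Build _ _ _ _ _ (p1 : (1%:E <= p%:E)%E) u fu.
pose U : Lp01 p1 := HB.pack u U0.
by exists U.
Qed.

(** The L_p space consists of classes, so only the distances of the chosen
    representatives, and not their values, can be prescribed. *)
Lemma Lp01_realize (X : Type) (g : X -> R -> R) :
  (forall x, measurable_fun setT (g x)) ->
  (forall x, (\int[P]_t (`|g x t| `^ p)%:E < +oo)%E) ->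
  exists F : X -> Lp01 p1, forall x y,
    Lp01_dist (F x) (F y) = ((\int[P]_t (`|g x t - g y t| `^ p)%:E) `^ p^-1)%E.
Proof.
move=> mg fg.
have /choice[F FP] : forall x, exists u : Lp01 p1, ae_eq P setT (u : R -> R) (g x).
  by move=> x; exact: Lp01_of_fun.
exists F => x y; rewrite Lp01_distE; congr poweR.
apply: (@ge0_ae_eq_integral _ _ _ P setT) => //.
- apply: (@measurable_norm_powR (fun t => F x t - F y t)).
  by apply: measurable_funB; exact: measurable_Lp01.
- apply: (@measurable_norm_powR (fun t => g x t - g y t)).
  exact: measurable_funB.
- by apply: filterS2 (FP x) (FP y) => t /= /(_ Logic.I) -> /(_ Logic.I) -> _.
Qed.

End LpRealization.

(** * Affine changes of variable on the unit interval *)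
Section UnitInterval.
Variable R : realType.
Local Notation P := (lebesgue01 R).
Local Notation mu := (@lebesgue_measure R).

Lemma lebesgue01E (A : set R) : P A = mu (A `&` `[0, 1]).
Proof. by []. Qed.

Lemma lebesgue01T : P setT = 1%E.
Proof. by rewrite lebesgue01E setTI lebesgue_measure_itv /= lte_fin ltr01 sube0. Qed.

(** The half-open interval is the one that the dyadic pieces and the doubling
    map below partition exactly. *)
Lemma integral_lebesgue01 (f : R -> \bar R) : measurable_fun setT f ->
  (forall x, 0 <= f x)%E ->
  (\int[P]_x f x = \int[mu]_(x in `]0%R, 1%R]) f x)%E.
Proof.
move=> mf f0.
rewrite integral_itv_obnd_cbnd; last exact: measurable_funTS.
have mI : measurable (`[0%R, 1%R] : set R) by exact: measurable_itv.
rewrite -(setUv (`[0%R, 1%R] : set R)) ge0_integral_setU //.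
- rewrite [X in (_ + X)%E]null_set_integral ?adde0; first last.
  + by rewrite lebesgue01E setIC setICr measure0.
  + exact: measurable_funTS.
  + exact: measurableC.
  apply: eq_measure_integral => A mA AI.
  by rewrite [LHS]lebesgue01E setIidl.
- exact: measurableC.
- by rewrite setUv.
- by rewrite disj_set2E setICr.
Qed.

Definition affine (a b x : R) := a * x + b.

Lemma measurable_affine a b : measurable_fun setT (affine a b).
Proof.
apply: measurable_funD => //; exact: measurable_funM.
Qed.

Lemma lebesgue_measure_affine (a b : R) (A : set R) : 0 < a -> measurable A ->
  mu (affine a b @^-1` A) = (a^-1%:E * mu A)%E.
Proof.
move=> a0 mA.
pose k : {nonneg R} := NngNum (ltW a0).
suff -> : mu A = (a%:E * mu (affine a b @^-1` A))%E.
  by rewrite muleA -EFinM mulVf ?mul1e ?gt_eqF.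
pose A0 := isMeasurableFun.Build _ _ (measurableTypeR R) (measurableTypeR R) _
  (measurable_affine a b).
pose ab : {mfun measurableTypeR R >-> measurableTypeR R} := HB.pack (affine a b) A0.
(* the scaled image measure agrees with Lebesgue measure on intervals *)
apply: (@lebesgue_measure_unique R (mscale k (pushforward mu ab))) => // X /= [[x y]] _ <-.
rewrite /mscale /= -[pushforward _ _ _]/(mu (affine a b @^-1` `]x, y])).
have -> : affine a b @^-1` `]x, y] = `](x - b) / a, (y - b) / a]%classic.
  apply/seteqP; split => t /=;
    rewrite !in_itv /= /affine ltr_pdivrMr // ler_pdivlMr //.
    by rewrite (mulrC t a); lra.
  by rewrite (mulrC t a); lra.
rewrite !lebesgue_measure_itv /= !lte_fin ltr_pM2r ?invr_gt0 // ltrD2r.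
case: ifP => _; last by rewrite mule0.
by rewrite -!EFinB -EFinM; congr EFin; field; rewrite gt_eqF.
Qed.

Lemma integral_affine (a b : R) (D : set R) (f : R -> \bar R) : 0 < a ->
  measurable D -> measurable_fun setT f -> (forall x, 0 <= f x)%E ->
  (\int[mu]_(x in affine a b @^-1` D) f (affine a b x)
   = a^-1%:E * \int[mu]_(x in D) f x)%E.
Proof.
move=> a0 mD mf f0.
have ma : measurable_fun setT (affine a b : measurableTypeR R -> measurableTypeR R).
  exact: measurable_affine.
rewrite -(@ge0_integral_pushforward _ _ (measurableTypeR R) (measurableTypeR R) _
  (affine a b) ma mu D f) //.
- have k0 : 0 <= a^-1 by rewrite invr_ge0 ltW.
  rewrite -[RHS](@ge0_integral_mscale _ _ _ mu D mD (NngNum k0) f) //.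
  + apply: eq_measure_integral => A mA _.
    exact: (lebesgue_measure_affine b a0 mA).
  + exact: measurable_funTS.
- exact: measurable_funTS.
Qed.

End UnitInterval.

(** * Cut metrics and their L_p snowflakes *)
Section Cuts.
Variables (R : realType) (X : Type).
Local Notation P := (lebesgue01 R).
Local Notation mu := (@lebesgue_measure R).

Definition sep (E : X -> R -> bool) (x y : X) : set R :=
  [set w | E x w != E y w].

Lemma measurable_sep (E : X -> R -> bool) x y :
  (forall x, measurable [set w | E x w]) -> measurable (sep E x y).
Proof.
move=> mE.
have -> : sep E x y = ([set w | E x w] `&` ~` [set w | E y w])
                  `|` ([set w | E y w] `&` ~` [set w | E x w]).
  apply/seteqP; split => w /=; rewrite /sep /=.
    by case: (E x w) (E y w) => [] []// _; [left|right].
  by case: (E x w) (E y w) => [] [] // [] [].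
by apply: measurableU; apply: measurableI => //; exact: measurableC.
Qed.

Definition cut_metric (J : choiceType) (E : J -> X -> R -> bool) (x y : X) : \bar R :=
  \esum_(j in [set: J]) P (sep (E j) x y).

Definition dyadic (k : nat) : set R := `](2 ^+ k.+1)^-1, (2 ^+ k)^-1].

(** [stretch k] maps the k-th dyadic interval affinely onto ]0, 1]. *)
Definition stretch (k : nat) : R -> R := affine (2 ^+ k.+1) (-1).

Lemma dyadicE k : dyadic k = stretch k @^-1` `]0, 1].
Proof.
have h : (0 : R) < 2 ^+ k.+1 by rewrite exprn_gt0.
apply/seteqP; split => t /=; rewrite /dyadic /stretch /affine /= !in_itv /=.
  move=> /andP[t1 t2]; rewrite subr_gt0 -ltr_pdivrMl // mulr1 t1 /=.
  by rewrite lerBlDr -ler_pdivlMl // exprS invfM; lra.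
move=> /andP[t1 t2]; rewrite subr_gt0 -ltr_pdivrMl // mulr1 in t1.
by rewrite t1 /=; move: t2; rewrite lerBlDr -ler_pdivlMl // exprS invfM; lra.
Qed.

Lemma measurable_dyadic k : measurable (dyadic k).
Proof. exact: measurable_itv. Qed.

Lemma trivIset_dyadic : trivIset setT dyadic.
Proof.
apply/trivIsetP => i j _ _; wlog ij : i j / (i < j)%N => [h|_].
  by case: ltngtP => // ij _; [apply: h|rewrite setIC; apply: h]; rewrite // ltn_eqF.
apply/seteqP; split => // t []; rewrite /dyadic /= !in_itv /= => /andP[ti _] /andP[_ tj].
have : (2 ^+ j)^-1 <= (2 ^+ i.+1)^-1 :> R.
  by rewrite lef_pV2 ?posrE ?exprn_gt0 // ler_eXn2l // ltr1n.
by move=> /(le_trans tj)/(lt_le_trans ti); rewrite ltxx.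
Qed.

Lemma bigcup_dyadic : \bigcup_k dyadic k = `]0, 1]%classic.
Proof.
apply/seteqP; split => [t [k _]|t]; rewrite /dyadic /= !in_itv /=.
  move=> /andP[t1 t2]; rewrite (lt_trans _ t1) ?invr_gt0 ?exprn_gt0 //=.
  by rewrite (le_trans t2) // invf_le1 ?exprn_gt0 // exprn_ege1 // ler1n.
move=> /andP[t0 t1].
have ex : exists n, (2 ^+ n.+1)^-1 < t.
  exists (Num.trunc t^-1).
  rewrite invf_plt ?posrE ?exprn_gt0 // (lt_trans (truncnS_gt _)) //.
  by rewrite -natrX ltr_nat ltn_expl.
case: (ex_minnP ex) => -[|n] tn nmin; [exists 0%N|exists n.+1] => //=; rewrite in_itv /= tn //=.
  by rewrite expr0 invr1.
by rewrite leNgt; apply/negP => /nmin; rewrite ltnn.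
Qed.

End Cuts.

Section Snowflake.
Variables (R : realType) (X : Type) (E : nat -> X -> R -> bool) (p : R) (o : X).
Hypotheses (p1 : 1 <= p) (mE : forall k x, measurable [set w | E k x w]).
Local Notation P := (lebesgue01 R).
Local Notation mu := (@lebesgue_measure R).

Let code (t : R) : nat := xget 0%N [set k | dyadic k t].

Let codeE k t : dyadic k t -> code t = k.
Proof.
move=> kt; rewrite /code; case: xgetP => [i _ it|/(_ k)//].
by apply: (@trivIset_dyadic R i k) => //; exists t.
Qed.

Let piece k x (t : R) : R :=
  (2 ^+ k.+1) `^ p^-1 * ((E k x (stretch k t))%:R - (E k o (stretch k t))%:R).

(** The k-th cut is copied onto the k-th dyadic interval. The factor compensates
    the length 2^-(k+1) of that interval, and subtracting the cut of the base
    point o makes the function p-integrable. *)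
Definition snowflake x (t : R) : R :=
  if t \in `]0, 1] then piece (code t) x t else 0.

Let snowflakeE k x t : dyadic k t -> snowflake x t = piece k x t.
Proof.
move=> kt; rewrite /snowflake (codeE kt) ifT //.
have : (\bigcup_k dyadic k) t by exists k.
by rewrite bigcup_dyadic.
Qed.

Lemma measurable_snowflake x : measurable_fun setT (snowflake x).
Proof.
rewrite -(setUv (`]0, 1]%classic : set R)).
have mI : measurable (`]0, 1]%classic : set R) by exact: measurable_itv.
apply/measurable_funU => //; first exact: measurableC.
split; last first.
  apply: (@eq_measurable_fun _ _ _ _ _ (cst 0 : R -> R)); last exact: measurable_cst.
  by move=> t; rewrite inE /= /snowflake => /negP/negPf ->.
rewrite -bigcup_dyadic; apply/measurable_fun_bigcup => k; first exact: measurable_dyadic.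
apply: (@eq_measurable_fun _ _ _ _ _ (piece k x)).
  by move=> t; rewrite inE => /snowflakeE ->.
apply: measurable_funTS; apply: measurable_funM; first exact: measurable_cst.
have mpiece y : measurable_fun setT (fun t => (E k y (stretch k t))%:R : R).
  have -> : (fun t => (E k y (stretch k t))%:R) = (\1_[set w | E k y w] : R -> R) \o stretch k.
    apply/funext => t /=; rewrite indicE; congr (_%:R); congr nat_of_bool.
    by apply/idP/idP => [h|]; rewrite inE.
  apply: measurableT_comp; first exact: measurable_indic.
  exact: measurable_affine.
exact: measurable_funB.
Qed.

Lemma snowflake_base t : snowflake o t = 0.
Proof. by rewrite /snowflake /piece subrr mulr0; case: ifP. Qed.

(** On each dyadic interval the p-th power of the difference is the indicator of
    the separating event, times the factor that the change of variable removes. *)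
Lemma snowflake_dist x y :
  (\int[P]_t (`|snowflake x t - snowflake y t| `^ p)%:E = cut_metric E x y)%E.
Proof.
have p0 : p != 0 by rewrite gt_eqF // (lt_le_trans ltr01).
rewrite /cut_metric -nneseries_esumT // integral_lebesgue01; last 2 first.
  apply: (@measurable_norm_powR R p (fun t => snowflake x t - snowflake y t)).
  by apply: measurable_funB; exact: measurable_snowflake.
  by move=> t; rewrite lee_fin powR_ge0.
rewrite -bigcup_dyadic ge0_integral_bigcup; last 4 first.
- exact: measurable_dyadic.
- apply: measurable_funTS.
  apply: (@measurable_norm_powR R p (fun t => snowflake x t - snowflake y t)).
  by apply: measurable_funB; exact: measurable_snowflake.
- by move=> t; rewrite lee_fin powR_ge0.
- exact: trivIset_dyadic.
apply: eq_eseriesr => k _.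
have mS : measurable (sep (E k) x y) by exact: measurable_sep.
have k0 : (0 : R) < 2 ^+ k.+1 by rewrite exprn_gt0.
transitivity (\int[mu]_(t in dyadic k)
    ((2 ^+ k.+1)%:E * (EFin \o \1_(sep (E k) x y)) (stretch k t)))%E.
  apply: eq_integral => t; rewrite inE => kt.
  rewrite !(snowflakeE _ kt) /piece -mulrBr opprB addrA subrK.
  rewrite normrM powRM // ger0_norm ?powR_ge0 // -powRrM mulVf // powRr1 ?ltW // EFinM.
  congr (_ * _)%E; rewrite /= indicE; congr EFin.
  have -> : (stretch k t \in sep (E k) x y) = (E k x (stretch k t) != E k y (stretch k t)).
    by apply/idP/idP; rewrite inE.
  by case: (E k x _) (E k y _) => [] [] /=;
    rewrite ?subrr ?subr0 ?sub0r ?normrN ?normr0 ?normr1 ?powR1 ?powR0.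
have m1 : measurable_fun setT (EFin \o \1_(sep (E k) x y) : R -> \bar R).
  by apply/measurable_EFinP; exact: measurable_indic.
rewrite ge0_integralZl //; last 3 first.
- exact: measurable_dyadic.
- by apply: measurable_funTS; apply: measurableT_comp => //; exact: measurable_affine.
- by move=> t _; rewrite /= lee_fin.
have f0 t : (0 <= (EFin \o \1_(sep (E k) x y)) t)%E by rewrite /= lee_fin.
rewrite dyadicE integral_affine // muleA -EFinM mulfV ?gt_eqF // mul1e.
by rewrite -integral_lebesgue01 // integral_indic // setIT.
Qed.

End Snowflake.

(** * Rademacher functions and Khintchine's inequality *)
Section Rademacher.
Variable R : realType.
Local Notation P := (lebesgue01 R).
Local Notation mu := (@lebesgue_measure R).

Definition doubling (t : R) : R := if t <= 2^-1 then 2 * t else 2 * t - 1.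

Definition rademacher (k : nat) (t : R) : R :=
  if iter k doubling t <= 2^-1 then 1 else -1.

(** The position after N steps of a random walk whose k-th step is c k with a
    random sign. *)
Definition walk (N : nat) (c : nat -> R) (t : R) : R :=
  \sum_(k < N) c k * rademacher k t.

Lemma measurable_half d (T : measurableType d) (f g : R -> T) :
  measurable_fun setT f -> measurable_fun setT g ->
  measurable_fun setT (fun t : R => if t <= 2^-1 then f t else g t).
Proof.
move=> mf mg; apply: measurable_fun_ifT => //.
exact: (@measurable_fun_ler _ R R setT (fun t : R => t) (cst 2^-1)).
Qed.

(** The measure-theoretic content is that the first binary digit is a fair coin
    independent of the other digits. *)
Lemma integral_half (f g : R -> \bar R) :
  measurable_fun setT f -> measurable_fun setT g ->
  (forall t, 0 <= f t)%E -> (forall t, 0 <= g t)%E ->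
  (\int[P]_t (if (t <= 2^-1)%R then f (2 * t)%R else g (2 * t - 1)%R)
   = 2^-1%:E * (\int[P]_t f t + \int[P]_t g t))%E.
Proof.
move=> mf mg f0 g0.
have ma (b : R) : measurable_fun setT (fun t : R => 2 * t + b).
  exact: (measurable_affine 2 b).
have mfa : measurable_fun setT (fun t : R => f (2 * t)%R).
  by have := measurableT_comp mf (ma 0); under eq_fun do rewrite /= addr0.
have mga : measurable_fun setT (fun t : R => g (2 * t - 1)%R).
  exact: (measurableT_comp mg (ma (-1))).
have mh := measurable_half mfa mga.
rewrite (integral_lebesgue01 mh); last by move=> t; case: ifP.
have -> : `]0, 1]%classic = `]0, 2^-1]%classic `|` `]2^-1, 1]%classic :> set R.
  apply/seteqP; split => t /=; rewrite !in_itv /=.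
    by case: (leP t 2^-1) => h /andP[-> ->]; [left|right].
  by case => /andP[h1 h2]; apply/andP; split; lra.
have dj : [disjoint `]0, 2^-1]%classic & `]2^-1, 1]%classic :> set R].
  apply/disj_setPS => t /= []; rewrite !in_itv /= => /andP[_ h1] /andP[h2 _].
  by have := lt_le_trans h2 h1; rewrite ltxx.
rewrite ge0_integral_setU //; last 2 first.
- exact: measurable_funTS.
- by move=> t _; case: ifP.
have h1 : `]0, 2^-1]%classic = affine 2 0 @^-1` `]0, 1]%classic :> set R.
  by apply/seteqP; split => t; rewrite /affine /= !in_itv /=; lra.
have h2 : `]2^-1, 1]%classic = affine 2 (-1) @^-1` `]0, 1]%classic :> set R.
  by apply/seteqP; split => t; rewrite /affine /= !in_itv /=; lra.
rewrite [X in (X + _)%E](_ : _ =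
    \int[mu]_(t in affine 2 0 @^-1` `]0%R, 1%R]) f (affine 2 0 t))%E; last first.
  rewrite -h1; apply: eq_integral => t; rewrite inE /= in_itv /= /affine addr0.
  by move=> /andP[_ ->].
rewrite [X in (_ + X)%E](_ : _ =
    \int[mu]_(t in affine 2 (-1) @^-1` `]0%R, 1%R]) g (affine 2 (-1) t))%E; last first.
  rewrite -h2; apply: eq_integral => t; rewrite inE /= in_itv /= /affine.
  by move=> /andP[h _]; rewrite leNgt h.
rewrite !integral_affine // !integral_lebesgue01 // -ge0_muleDr //; exact: integral_ge0.
Qed.

Lemma measurable_rademacher k : measurable_fun setT (rademacher k).
Proof.
have md : measurable_fun setT doubling.
  apply: measurable_half; first exact: measurable_funM.
  exact: (measurable_affine 2 (-1)).
have mi : measurable_fun setT (fun t => iter k doubling t).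
  by elim: k => [|k IHk] //=; exact: (measurableT_comp md IHk).
have m1 : measurable_fun setT (fun t : R => if t <= 2^-1 then 1 else -1 : R).
  exact: measurable_half.
exact: (measurableT_comp m1 mi).
Qed.

Lemma measurable_walk N c : measurable_fun setT (walk N c).
Proof.
apply: measurable_sum => k; apply: measurable_funM => //.
exact: measurable_rademacher.
Qed.

Lemma walkS N c t : walk N.+1 c t =
  if t <= 2^-1 then c 0 + walk N (c \o S) (2 * t)
  else - c 0 + walk N (c \o S) (2 * t - 1).
Proof.
rewrite /walk big_ord_recl /= {1}/rademacher /=.
under eq_bigr => k _ do rewrite /rademacher iterSr.
by rewrite /doubling; case: ifP => _; rewrite ?mulr1 ?mulrN1.
Qed.

Lemma walk_sub N c d t : walk N c t - walk N d t = walk N (fun k => c k - d k) t.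
Proof. by rewrite /walk -sumrB; apply: eq_bigr => k _; rewrite mulrBl. Qed.

Lemma walkZ N a c t : walk N (fun k => a * c k) t = a * walk N c t.
Proof. by rewrite /walk mulr_sumr; apply: eq_bigr => k _; rewrite mulrA. Qed.

Lemma walk_widen m N c t : (m <= N)%N -> (forall k, (m <= k)%N -> c k = 0) ->
  walk N c t = walk m c t.
Proof.
move=> mN c0; rewrite /walk (big_ord_widen N (fun k => c k * rademacher k t) mN).
rewrite [RHS]big_mkcond /=; apply: eq_bigr => k _.
by case: ltnP => // /c0 ->; rewrite mul0r.
Qed.

(** Conditioning on the first sign: the remaining steps form a walk of the same
    kind, evaluated at the doubled point. Both moment computations below are
    inductions on this identity. *)
Lemma integral_walkS N c (phi : R -> R) : measurable_fun setT phi ->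
  (forall t, 0 <= phi t) ->
  (\int[P]_t (phi (walk N.+1 c t))%:E = 2^-1%:E *
    (\int[P]_t (phi (c 0%N + walk N (c \o S) t)%R)%:E +
     \int[P]_t (phi (- c 0%N + walk N (c \o S) t)%R)%:E))%E.
Proof.
move=> mphi phi0.
have mw (b : R) : measurable_fun setT (fun t => (phi (b + walk N (c \o S) t))%:E).
  apply/measurable_EFinP; apply: (measurableT_comp mphi).
  by apply: measurable_funD => //; exact: measurable_walk.
rewrite -(integral_half (mw _) (mw _)).
- by apply: eq_integral => t _; rewrite walkS; case: ifP.
- by move=> t; rewrite lee_fin.
- by move=> t; rewrite lee_fin.
Qed.

Lemma walk_sqr N c : (\int[P]_t (walk N c t ^+ 2)%:E = (\sum_(k < N) c k ^+ 2)%:E)%E.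
Proof.
elim: N c => [|N IHN] c.
  rewrite big_ord0 (eq_integral (cst 0%E)) ?integral0 // => t _.
  by rewrite /walk big_ord0 expr0n.
have mX : measurable_fun setT (fun t : R => t ^+ 2) by exact: measurable_funX.
rewrite (@integral_walkS N c (fun t => t ^+ 2)) //; last by move=> t; exact: sqr_ge0.
have mw (b : R) : measurable_fun setT (fun t => ((b + walk N (c \o S) t) ^+ 2)%:E).
  apply/measurable_EFinP; apply: (measurableT_comp mX).
  by apply: measurable_funD => //; exact: measurable_walk.
rewrite -ge0_integralD //; last 4 first.
- by move=> t _; rewrite lee_fin sqr_ge0.
- exact: mw.
- by move=> t _; rewrite lee_fin sqr_ge0.
- exact: mw.
have mW2 : measurable_fun setT (fun t => (walk N (c \o S) t ^+ 2)%:E).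
  apply/measurable_EFinP; apply: (measurableT_comp mX); exact: measurable_walk.
transitivity (2^-1%:E * \int[P]_t ((2 * c 0%N ^+ 2)%:E + 2%:E * (walk N (c \o S) t ^+ 2)%:E))%E.
  congr (_ * _)%E; apply: eq_integral => t _.
  by rewrite -EFinM -!EFinD; congr EFin; ring.
rewrite ge0_integralD //; last 3 first.
- by move=> t _; rewrite lee_fin mulr_ge0 // sqr_ge0.
- by move=> t _; rewrite -EFinM lee_fin mulr_ge0 // sqr_ge0.
- by apply: emeasurable_funM => //; exact: measurable_cst.
rewrite integral_cst // lebesgue01T mule1 ge0_integralZl_EFin //; last first.
  by move=> t _; rewrite lee_fin sqr_ge0.
rewrite IHN big_ord_recl /= -(EFinM 2) -EFinD -EFinM; congr EFin.
by rewrite -mulrDr mulKf.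
Qed.

(** The constant 2 instead of the sharp 1/2 lets the proof use only
    1 + x <= exp x: for x < 1/2 through 1/(1 - x^2), otherwise x <= 2 x^2. *)
Lemma cosh_le (x : R) : 2^-1 * (expR x + expR (- x)) <= expR (2 * x ^+ 2).
Proof.
wlog x0 : x / 0 <= x => [h|].
  case: (leP 0 x) => [/h//|/ltW x0]; have := h (- x).
  by rewrite opprK sqrrN addrC; apply; rewrite oppr_ge0.
case: (leP 2^-1 x) => hx.
  have h1 : expR x <= expR (2 * x ^+ 2) by rewrite ler_expR; nra.
  have h2 : expR (- x) <= expR (2 * x ^+ 2) by rewrite ler_expR; nra.
  lra.
have e1 : expR x <= (1 - x)^-1.
  rewrite -[x in expR x]opprK expRN lef_pV2 ?posrE ?expR_gt0 //; last lra.
  exact: expR_ge1Dx.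
have e2 : expR (- x) <= (1 + x)^-1.
  rewrite expRN lef_pV2 ?posrE ?expR_gt0 //; last lra.
  exact: expR_ge1Dx.
apply: (@le_trans _ _ (2^-1 * ((1 - x)^-1 + (1 + x)^-1))); first lra.
apply: le_trans (expR_ge1Dx _).
have -> : 2^-1 * ((1 - x)^-1 + (1 + x)^-1) = (1 - x ^+ 2)^-1.
  by field; rewrite !gt_eqF //; nra.
have u0 := sqr_ge0 x; have u1 : x ^+ 2 <= 4^-1 by nra.
by rewrite -[leLHS]mulr1 ler_pdivrMl; nra.
Qed.

Lemma walk_expR N c :
  (\int[P]_t (expR (walk N c t))%:E <= (expR (2 * \sum_(k < N) c k ^+ 2))%:E)%E.
Proof.
elim: N c => [|N IHN] c.
  rewrite big_ord0 mulr0 (eq_integral (cst (expR 0)%:E)); last first.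
    by move=> t _; rewrite /walk big_ord0.
  by rewrite integral_cst // lebesgue01T mule1.
rewrite (@integral_walkS N c expR) //.
have mW : measurable_fun setT (fun t => (expR (walk N (c \o S) t))%:E).
  apply/measurable_EFinP.
  exact: (measurableT_comp (@measurable_expR R) (measurable_walk _ _)).
have E (b : R) : (\int[P]_t (expR (b + walk N (c \o S) t)%R)%:E =
   (expR b)%:E * \int[P]_t (expR (walk N (c \o S) t))%:E)%E.
  under eq_integral do rewrite expRD EFinM.
  by rewrite ge0_integralZl_EFin // => t _; rewrite lee_fin expR_ge0.
rewrite !E -ge0_muleDl ?lee_fin ?expR_ge0 // muleA -EFinD -EFinM.
apply: (@le_trans _ _ ((expR (2 * c 0%N ^+ 2))%:E *
    (expR (2 * \sum_(k < N) (c \o S) k ^+ 2))%:E)%E).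
  apply: lee_pmul => //.
  - by apply: integral_ge0 => t _; rewrite lee_fin expR_ge0.
  - by rewrite lee_fin; exact: cosh_le.
rewrite -EFinM -expRD -mulrDr big_ord_recl lee_fin.
by under [in leRHS]eq_bigr do rewrite lift0.
Qed.

Variable p : R.

(** From t <= exp t at t = |x| / p, raised to the power p. *)
Lemma powR_le_expR (x : R) : 1 <= p -> `|x| `^ p <= p `^ p * (expR x + expR (- x)).
Proof.
move=> p1; have p0 : 0 < p by apply: lt_le_trans p1.
have : `|x| <= p * expR (`|x| / p).
  rewrite -ler_pdivrMl // mulrC (le_trans _ (expR_ge1Dx _)) // lerDr //.
have h0 : 0 <= p * expR (`|x| / p) by rewrite mulr_ge0 ?expR_ge0 // ltW.
move=> /(ge0_ler_powR (ltW p0)) -/(_ _ _)/le_trans; apply; rewrite ?nnegrE //.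
rewrite powRM ?expR_ge0 ?(ltW p0) // -expRM divfK ?gt_eqF // ler_wpM2l ?powR_ge0 //.
have [x0|x0] := leP 0 x; last by rewrite ler0_norm ?lerDr ?expR_ge0 // ltW.
by rewrite ger0_norm ?lerDl ?expR_ge0.
Qed.

Let walk_moment1 N (c : nat -> R) : 1 <= p -> \sum_(k < N) c k ^+ 2 = 1 ->
  (\int[P]_t (`|walk N c t| `^ p)%:E <= (p `^ p * (2 * expR 2))%:E)%E.
Proof.
move=> p1 c1.
have mE d : measurable_fun setT (fun t => (expR (walk N d t))%:E).
  apply/measurable_EFinP.
  exact: (measurableT_comp (@measurable_expR R) (measurable_walk _ _)).
have nE t : expR (- walk N c t) = expR (walk N (fun k => - c k) t).
  by congr expR; rewrite /walk -sumrN; apply: eq_bigr => k _; rewrite mulNr.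
apply: (@le_trans _ _ (\int[P]_t ((p `^ p)%:E * ((expR (walk N c t))%:E +
    (expR (walk N (fun k => - c k) t))%:E)))%E).
  apply: ge0_le_integral => //.
  - by apply: measurable_norm_powR; exact: measurable_walk.
  - by apply: emeasurable_funM; [exact: measurable_cst|apply: emeasurable_funD; exact: mE].
  - by move=> t _; rewrite -nE -EFinD -EFinM lee_fin; exact: powR_le_expR.
rewrite ge0_integralZl_EFin ?powR_ge0 //; last 2 first.
- by move=> t _; rewrite -EFinD lee_fin addr_ge0 ?expR_ge0.
- by apply: emeasurable_funD; exact: mE.
rewrite EFinM lee_pmul2l ?lte_fin ?powR_gt0 ?(lt_le_trans ltr01) //.
rewrite ge0_integralD //; last 2 first.
- exact: mE.
- exact: mE.
apply: (le_trans (leeD (walk_expR _ _) (walk_expR _ _))).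
under [X in (_ + (expR (2 * X))%:E)%E]eq_bigr do rewrite sqrrN.
by rewrite c1 mulr1 -EFinD lee_fin; lra.
Qed.

(** Pointwise, W^2 <= 1/2 + 2^(p-2) |W|^p: the first term suffices when
    |W| <= 1/2 and the second one otherwise. As the mean of W^2 is 1, the mean of
    |W|^p is bounded below. *)
Let walk_lower1 N (c : nat -> R) : 2 <= p -> \sum_(k < N) c k ^+ 2 = 1 ->
  ((2^-1 * 2 `^ (2 - p))%:E <= \int[P]_t (`|walk N c t| `^ p)%:E)%E.
Proof.
move=> p2 c1.
have mX : measurable_fun setT (fun t : R => t ^+ 2) by exact: measurable_funX.
have mW : measurable_fun setT (fun t => (walk N c t ^+ 2)%:E).
  apply/measurable_EFinP; apply: (measurableT_comp mX); exact: measurable_walk.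
have mWp : measurable_fun setT (fun t => (`|walk N c t| `^ p)%:E).
  by apply: measurable_norm_powR; exact: measurable_walk.
have q0 : 0 < 2 `^ (2 - p) :> R by rewrite powR_gt0.
have : (\int[P]_t (walk N c t ^+ 2)%:E <=
   \int[P]_t (2^-1%:E + ((2 `^ (2 - p))^-1)%:E * (`|walk N c t| `^ p)%:E))%E.
  apply: ge0_le_integral => //.
  - by move=> t _; rewrite lee_fin sqr_ge0.
  - by apply: emeasurable_funD => //; apply: emeasurable_funM.
  - move=> t _; rewrite -EFinM -EFinD lee_fin -(real_normK (num_real _)).
    set x := `|_|; have x0 : 0 <= x by exact: normr_ge0.
    have [x2|x2] := leP x 2^-1.
      have : 0 <= (2 `^ (2 - p))^-1 * x `^ p; last by nra.
      by rewrite mulr_ge0 ?powR_ge0 // invr_ge0 ltW.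
    have -> : x `^ p = x ^+ 2 * x `^ (p - 2).
      by rewrite -powR_mulrn // -powRD; [congr powR; ring|rewrite gt_eqF ?implybT //; lra].
    have h : (2 `^ (2 - p)) <= x `^ (p - 2).
      rewrite -[2 - p]opprB powRN -powR_inv1 // -powRrM mulrC powRrM powR_inv1 ?powR_ge0 //.
      by apply: ge0_ler_powR; rewrite ?nnegrE ?subr_ge0 //; lra.
    rewrite mulrCA.
    have : 1 <= (2 `^ (2 - p))^-1 * x `^ (p - 2) by rewrite ler_pdivlMl // mulr1.
    nra.
have iV : 0 <= (2 `^ (2 - p))^-1 :> R by rewrite invr_ge0 ltW.
have i0 t : (0 <= ((2 `^ (2 - p))^-1)%:E * (`|walk N c t| `^ p)%:E)%E.
  by rewrite -EFinM lee_fin mulr_ge0 ?powR_ge0.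
rewrite walk_sqr c1 ge0_integralD //; last by apply: emeasurable_funM.
rewrite integral_cst // lebesgue01T mule1 ge0_integralZl_EFin //.
have : (0 <= \int[P]_t (`|walk N c t| `^ p)%:E)%E.
  by apply: integral_ge0 => t _; rewrite lee_fin powR_ge0.
case: (\int[P]_t _)%E => [r _|_ _|//].
  rewrite -EFinM -EFinD !lee_fin => h.
  have : 2^-1 <= (2 `^ (2 - p))^-1 * r by lra.
  by rewrite ler_pdivlMl // mulrC.
by rewrite leey.
Qed.

(** Both bounds are homogeneous of degree p in c, which reduces them to the case
    of norm 1. *)
Lemma khintchine : 2 <= p -> exists2 A : R * R, 0 < A.1 /\ 0 < A.2 & forall N (c : nat -> R),
  let v := (\sum_(k < N) c k ^+ 2) `^ (p / 2) in
  (\int[P]_t (`|walk N c t| `^ p)%:E <= (A.2 * v)%:E)%E /\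
  ((A.1 * v)%:E <= \int[P]_t (`|walk N c t| `^ p)%:E)%E.
Proof.
move=> p2; have p1 : 1 <= p by apply: le_trans p2; rewrite ler1n.
have p0 : 0 < p by apply: lt_le_trans p1.
exists (2^-1 * 2 `^ (2 - p), p `^ p * (2 * expR 2)).
  by split; rewrite /= !mulr_gt0 ?powR_gt0 ?expR_gt0 ?invr_gt0.
move=> N c; set s := \sum_(k < N) _; move=> v /=.
have s0 : 0 <= s by apply: sumr_ge0 => k _; exact: sqr_ge0.
have [s_eq|s_neq] := eqVneq s 0.
  have c0 (k : 'I_N) : c k = 0.
    move/eqP: s_eq; rewrite psumr_eq0 => [|i _]; last exact: sqr_ge0.
    by move=> /allP /(_ k (mem_index_enum _)); rewrite sqrf_eq0 => /eqP.
  have w0 t : walk N c t = 0 by rewrite /walk big1 // => k _; rewrite c0 mul0r.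
  have -> : v = 0 by rewrite /v s_eq powR0 // mulf_neq0 ?gt_eqF ?invr_gt0.
  rewrite !mulr0; under eq_integral do rewrite w0 normr0 powR0 ?gt_eqF //.
  by rewrite integral0.
pose r := Num.sqrt s; have r0 : 0 < r by rewrite sqrtr_gt0 lt_def s_neq.
have rr : r ^+ 2 = s by rewrite sqr_sqrtr.
have vE : v = r `^ p.
  by rewrite /v -rr -powR_mulrn ?ltW // -powRrM; congr powR; field.
pose d k := r^-1 * c k.
have cE t : walk N c t = r * walk N d t.
  by rewrite -walkZ; apply: eq_bigr => k _; rewrite mulVKf ?gt_eqF.
have d1 : \sum_(k < N) d k ^+ 2 = 1.
  under eq_bigr do rewrite exprMn.
  by rewrite -mulr_sumr -/s -rr exprVn mulVf // expf_neq0 // gt_eqF.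
have -> : (\int[P]_t (`|walk N c t| `^ p)%:E = v%:E * \int[P]_t (`|walk N d t| `^ p)%:E)%E.
  under eq_integral do rewrite cE normrM powRM ?normr_ge0 // EFinM.
  rewrite ge0_integralZl_EFin ?powR_ge0 // ?vE ?gtr0_norm //.
  by apply: measurable_norm_powR; exact: measurable_walk.
have v0 : 0 < v by rewrite vE powR_gt0.
rewrite ![_ * v]mulrC !EFinM !lee_pmul2l ?lte_fin //.
by rewrite -!EFinM; split; [exact: walk_moment1|exact: walk_lower1].
Qed.

End Rademacher.

(** * Gram matrices and their Cholesky factorization *)
Section Cholesky.
Variable R : realType.
Implicit Types K : nat -> nat -> R.

(** Weighted points with repetitions, so that a point can be added to a
    configuration without knowing whether it already occurs there. *)
Definition quad K (s : seq (R * nat)) : R :=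
  \sum_(u <- s) \sum_(v <- s) u.1 * v.1 * K u.2 v.2.

Definition psd K := forall s, 0 <= quad K s.

(** Elimination of the k-th vector: the kernel of the components orthogonal to
    it. If K k k = 0, the convention x / 0 = 0 leaves K unchanged, as it should,
    since then the k-th row vanishes by [psd_diag0]. *)
Definition schur K (k m n : nat) : R := K m n - K m k * K n k / K k k.

Lemma quad_cons K (symK : forall m n, K m n = K n m) b k s :
  quad K ((b, k) :: s)
  = b ^+ 2 * K k k + 2 * b * (\sum_(u <- s) u.1 * K u.2 k) + quad K s.
Proof.
rewrite /quad big_cons big_cons /=.
under [X in _ + X = _]eq_bigr do rewrite big_cons /=.
rewrite big_split /= addrA; congr (_ + _).
rewrite expr2 -addrA; congr (_ + _).
have -> : \sum_(j <- s) b * j.1 * K k j.2 = b * \sum_(u <- s) u.1 * K u.2 k.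
  by rewrite mulr_sumr; apply: eq_bigr => u _; rewrite symK mulrA.
have -> : \sum_(i <- s) i.1 * b * K i.2 k = b * \sum_(u <- s) u.1 * K u.2 k.
  by rewrite mulr_sumr; apply: eq_bigr => u _; rewrite mulrA (mulrC b).
by ring.
Qed.

Lemma quad_schur K k s : quad (schur K k) s
  = quad K s - (\sum_(u <- s) u.1 * K u.2 k) ^+ 2 / K k k.
Proof.
rewrite /quad expr2 big_distrlr /= mulr_suml -sumrB; apply: eq_bigr => u _.
rewrite mulr_suml -sumrB; apply: eq_bigr => w _.
by rewrite /schur; ring.
Qed.

Lemma psd_diag K k : psd K -> 0 <= K k k.
Proof. by move=> /(_ [:: (1, k)]); rewrite /quad !big_seq1 /= !mul1r. Qed.

(** Adding the point k with the weight that minimizes the quadratic form of K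
    gives the quadratic form of the Schur complement. *)
Lemma psd_schur K k : (forall m n, K m n = K n m) -> psd K -> psd (schur K k).
Proof.
move=> symK pK s; rewrite quad_schur; set L := \sum_(u <- s) _.
have [k0|k0] := eqVneq (K k k) 0; first by rewrite k0 invr0 mulr0 subr0.
have := pK ((- (L / K k k), k) :: s); rewrite quad_cons // -/L.
by congr (_ <= _); field.
Qed.

(** A nonzero K m k would make the form affine and nonconstant in the weight of
    k, hence negative somewhere. *)
Lemma psd_diag0 K k m : (forall m n, K m n = K n m) -> psd K ->
  K k k = 0 -> K m k = 0.
Proof.
move=> symK pK k0; apply/eqP; apply: contraT => mk.
have := pK [:: (- (K m m + 1) / (2 * K m k), k); (1, m)].
rewrite quad_cons // k0 mulr0 add0r big_seq1 /= /quad !big_seq1 /= !mul1r.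
have -> : 2 * (- (K m m + 1) / (2 * K m k)) * K m k + K m m = -1 by field.
by rewrite lerNr oppr0 ler10.
Qed.

Fixpoint residual K (k : nat) : nat -> nat -> R :=
  if k is k'.+1 then schur (residual K k') k' else K.

Lemma residualP K k : (forall m n, K m n = K n m) -> psd K ->
  [/\ forall m n, residual K k m n = residual K k n m, psd (residual K k) &
      forall m i, (i < k)%N -> residual K k m i = 0].
Proof.
move=> symK pK; elim: k => [|k [symk pk zk]] //=; split.
- by move=> m n; rewrite /schur symk (mulrC (residual K k m k)).
- exact: psd_schur.
- move=> m i; rewrite ltnS leq_eqVlt => /predU1P[->|ik]; rewrite /schur.
    have [k0|k0] := eqVneq (residual K k k k) 0; last by rewrite mulfK ?subrr.
    by rewrite k0 invr0 mulr0 subr0; exact: psd_diag0.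
  by rewrite (zk m i ik) (symk i k) (zk k i ik) mulr0 mul0r subrr.
Qed.

Definition cholesky K m k : R := residual K k m k / Num.sqrt (residual K k k k).

(** Row m is finitely supported; this is what allows countably many vectors to
    be realized by finite Rademacher sums. *)
Lemma cholesky_ltn K m k : (forall m n, K m n = K n m) -> psd K ->
  (m < k)%N -> cholesky K m k = 0.
Proof.
move=> symK pK mk; have [symk _ zk] := residualP k symK pK.
by rewrite /cholesky symk zk // mul0r.
Qed.

Lemma choleskyE K m n N : (forall m n, K m n = K n m) -> psd K -> (m < N)%N ->
  K m n = \sum_(k < N) cholesky K m k * cholesky K n k.
Proof.
move=> symK pK mN.
suff h : residual K N m n = K m n - \sum_(k < N) cholesky K m k * cholesky K n k.
  have [symN _ zN] := residualP N symK pK.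
  by apply/eqP; rewrite -subr_eq0 -h symN zN.
elim: N {mN} => [|N IHN]; first by rewrite big_ord0 subr0.
rewrite big_ord_recr /= opprD addrA -IHN /schur; congr (_ - _).
have [_ pN _] := residualP N symK pK.
by rewrite /cholesky mulrACA -invfM -expr2 sqr_sqrtr ?psd_diag // mulrA.
Qed.

Lemma cholesky_dist K m n N : (forall m n, K m n = K n m) -> psd K ->
  (m < N)%N -> (n < N)%N ->
  K m m + K n n - 2 * K m n = \sum_(k < N) (cholesky K m k - cholesky K n k) ^+ 2.
Proof.
move=> symK pK mN nN.
rewrite (choleskyE m symK pK mN) (choleskyE n symK pK nN) (choleskyE n symK pK mN).
rewrite -big_split /= mulr_sumr -sumrB; apply: eq_bigr => k _; ring.
Qed.

End Cholesky.

(** * Embedding cut metrics into L_p *)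
Section Gram.
Variables (R : realType).
Local Notation P := (lebesgue01 R).

Lemma integrable_lincomb (I : Type) (s : seq I) (c : I -> R) (f : I -> R -> R) :
  (forall i, P.-integrable setT (EFin \o f i)) ->
  P.-integrable setT (EFin \o (fun t => \sum_(i <- s) c i * f i t)) /\
  Rintegral P setT (fun t => \sum_(i <- s) c i * f i t)
  = \sum_(i <- s) c i * Rintegral P setT (f i).
Proof.
move=> fi; elim: s => [|i s [IHi IHe]].
  rewrite big_nil; split.
    by under eq_fun do rewrite big_nil; exact: integrable0.
  rewrite /Rintegral; under eq_integral do rewrite big_nil.
  by rewrite integral0.
have ci : P.-integrable setT (EFin \o (fun t => c i * f i t)).
  have := integrableZl measurableT (c i) (fi i).
  by apply: eq_integrable => // t _; rewrite /= EFinM.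
split.
  have := integrableD measurableT ci IHi.
  by apply: eq_integrable => // t _; rewrite /= big_cons EFinD.
rewrite big_cons -IHe -(@RintegralZl _ _ _ P setT (f i) (c i)) // -RintegralD //.
by rewrite /Rintegral; congr fine; apply: eq_integral => t _; rewrite big_cons.
Qed.

Variables (X : Type) (g : X -> R -> R) (o : X).
Hypotheses (mg : forall x, measurable_fun setT (g x)) (go : forall t, g o t = 0).
Hypothesis fg : forall x y, (\int[P]_t ((g x t - g y t) ^+ 2)%:E < +oo)%E.

Definition sqdist x y : R := Rintegral P setT (fun t => (g x t - g y t) ^+ 2).

Definition gram x y : R := Rintegral P setT (fun t => g x t * g y t).

Let isq x y : P.-integrable setT (EFin \o (fun t => (g x t - g y t) ^+ 2)).
Proof.
have mh : measurable_fun setT (fun t => (g x t - g y t) ^+ 2).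
  by apply: measurable_funX; exact: measurable_funB.
apply/integrableP; split; first exact/measurable_EFinP.
under eq_integral do rewrite /= ger0_norm ?sqr_ge0 //.
exact: fg.
Qed.

(** Products are integrable by polarization: as g o = 0, both claims follow from
    the integrability of squared differences. *)
Let gramI x y : P.-integrable setT (EFin \o (fun t => g x t * g y t)) /\
  gram x y = 2^-1 * (sqdist x o + sqdist y o - sqdist x y).
Proof.
(* g x g y = (1/2) ((g x - g o)^2 + (g y - g o)^2 - (g x - g y)^2) *)
pose z (i : 'I_3) := if val i == 0%N then (x, o) else if val i == 1%N then (y, o) else (x, y).
pose c (i : 'I_3) : R := if val i == 2%N then - 2^-1 else 2^-1.
have [h1 h2] := integrable_lincomb (index_enum 'I_3) c (fun i => isq (z i).1 (z i).2).
have E t : \sum_(i < 3) c i * (g (z i).1 t - g (z i).2 t) ^+ 2 = g x t * g y t.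
  by rewrite !big_ord_recl big_ord0 /c /z /= go; field.
split; first by apply: eq_integrable h1 => // t _ /=; rewrite E.
rewrite /gram; under eq_Rintegral do rewrite -E.
by rewrite h2 !big_ord_recl big_ord0 /c /z /= /sqdist; field.
Qed.

Lemma gram_dist x y : gram x x + gram y y - 2 * gram x y = sqdist x y.
Proof.
have s0 z : sqdist z z = 0.
  rewrite /sqdist /Rintegral; under eq_integral do rewrite subrr expr0n.
  by rewrite integral0.
by rewrite !(gramI _ _).2 !s0; field.
Qed.

(** The quadratic form is the integral of the square of a linear combination. *)
Lemma psd_gram (v : nat -> X) : psd (fun m n => gram (v m) (v n)).
Proof.
move=> s; rewrite /quad.
pose f (u : R * nat) t := \sum_(w <- s) w.1 * (g (v u.2) t * g (v w.2) t).
have h (u : R * nat) := integrable_lincomb s fst (fun w => (gramI (v u.2) (v w.2)).1).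
have [_ h2] := integrable_lincomb s fst (fun u => (h u).1).
have -> : \sum_(u <- s) \sum_(w <- s) u.1 * w.1 * gram (v u.2) (v w.2)
  = Rintegral P setT (fun t => \sum_(u <- s) u.1 * f u t).
  rewrite h2; apply: eq_bigr => u _; rewrite (h u).2 mulr_sumr.
  by apply: eq_bigr => w _; rewrite mulrA.
apply: Rintegral_ge0 => t _.
have -> : \sum_(u <- s) u.1 * f u t = (\sum_(u <- s) u.1 * g (v u.2) t) ^+ 2.
  rewrite expr2 big_distrlr /=; apply: eq_bigr => u _.
  by rewrite /f mulr_sumr; apply: eq_bigr => w _; ring.
exact: sqr_ge0.
Qed.

Lemma gramC x y : gram x y = gram y x.
Proof. by apply: eq_Rintegral => t _; rewrite mulrC. Qed.

End Gram.

Section Embedding.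
Variables (R : realType) (X : Type) (E : nat -> X -> R -> bool) (o : X).
Variables (p : R) (p1 : 1 <= p).
Hypotheses (mE : forall k x, measurable [set w | E k x w]).
Hypothesis fE : forall x y, (cut_metric E x y < +oo)%E.
Local Notation P := (lebesgue01 R).
Local Notation psi x y := (fine (cut_metric E x y)).

Lemma cut_metric_ge0 x y : (0 <= cut_metric E x y)%E.
Proof. by apply: esum_ge0. Qed.

Lemma cut_metricE x y : cut_metric E x y = (psi x y)%:E.
Proof. by rewrite fineK // ge0_fin_numE // cut_metric_ge0. Qed.

Lemma embed_snowflake : exists F : X -> Lp01 p1, forall x y,
  Lp01_dist (F x) (F y) = (psi x y `^ p^-1)%:E.
Proof.
have [|x|F FE] := @Lp01_realize R p p1 X (snowflake E p o).
- exact: measurable_snowflake.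
- have := snowflake_dist o p1 mE x o; have := fE x o => /[swap] <-.
  by under eq_integral do rewrite snowflake_base subr0.
- by exists F => x y; rewrite FE snowflake_dist // cut_metricE poweR_EFin.
Qed.

(** At p = 2 the snowflake is a Hilbert space realization of the square root of
    the cut metric. The coordinates of its Cholesky factorization are used as
    the steps of Rademacher walks. *)
Lemma embed_hilbert (e : X -> nat) : injective e -> 2 <= p ->
  exists (F : X -> Lp01 p1) (A : R * R), [/\ 0 < A.1, 0 < A.2 & forall x y,
  ((A.1 * psi x y `^ 2^-1)%:E <= Lp01_dist (F x) (F y))%E /\
  (Lp01_dist (F x) (F y) <= (A.2 * psi x y `^ 2^-1)%:E)%E].
Proof.
move=> inj_e p2; have p0 : 0 < p by exact: lt_le_trans p1.
(* the points enumerated by e, with the base point at unused indices *)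
pose v n := if pselect (exists x, e x = n) is left h then sval (cid h) else o.
have vK x : v (e x) = x.
  by rewrite /v; case: pselect => [h|]; [apply: inj_e; case: (cid h)|case; exists x].
have le12 : 1 <= 2 :> R by rewrite ler1n.
pose g := snowflake E 2 o.
have gE x y : (\int[P]_t ((g x t - g y t) ^+ 2)%:E = (psi x y)%:E)%E.
  rewrite -cut_metricE -(snowflake_dist o le12) //; apply: eq_integral => t _.
  by rewrite powR_mulrn // real_normK ?num_real.
have mg x : measurable_fun setT (g x) by exact: measurable_snowflake.
have go t : g o t = 0 by exact: snowflake_base.
have fg x y : (\int[P]_t ((g x t - g y t) ^+ 2)%:E < +oo)%E by rewrite gE ltry.
pose K m n := gram g (v m) (v n).
have symK m n : K m n = K n m by exact: gramC.
have pK : psd K by exact: (psd_gram mg go fg).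
pose c := cholesky K.
have cE x y N : (e x < N)%N -> (e y < N)%N ->
    \sum_(k < N) (c (e x) k - c (e y) k) ^+ 2 = psi x y.
  move=> xN yN; rewrite -cholesky_dist // /K !vK (gram_dist mg go fg) /sqdist /Rintegral.
  by rewrite gE.
pose G x := walk (e x).+1 (c (e x)).
have GE x N t : (e x < N)%N -> G x t = walk N (c (e x)) t.
  by move=> xN; rewrite /G -(walk_widen t xN) // => k; exact: cholesky_ltn.
have [A [A1 A2] AP] := khintchine p2.
have AGP x y : (\int[P]_t (`|G x t - G y t| `^ p)%:E <= (A.2 * psi x y `^ (p / 2))%:E)%E /\
  ((A.1 * psi x y `^ (p / 2))%:E <= \int[P]_t (`|G x t - G y t| `^ p)%:E)%E.
  pose N := (maxn (e x) (e y)).+1.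
  have xN : (e x < N)%N by rewrite ltnS leq_maxl.
  have yN : (e y < N)%N by rewrite ltnS leq_maxr.
  have := AP N (fun k => c (e x) k - c (e y) k); rewrite (cE x y) //=.
  by under eq_integral do rewrite -walk_sub -!GE //.
have [|x|F FE] := @Lp01_realize R p p1 X G.
- by move=> x; exact: measurable_walk.
- have w0 : (\int[P]_t (`|walk (e x).+1 (c (e x)) t| `^ p)%:E < +oo)%E.
    by case: (AP (e x).+1 (c (e x))) => /le_lt_trans h _; apply: h; rewrite ltry.
  exact: w0.
have sq x y : (psi x y `^ (p / 2)) `^ p^-1 = psi x y `^ 2^-1.
  by rewrite -powRrM mulrAC mulfV ?gt_eqF // mul1r.
exists F, (A.1 `^ p^-1, A.2 `^ p^-1); rewrite /= !powR_gt0 //; split => // x y.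
rewrite FE; have [ub lb] := AGP x y.
have p10 : 0 <= p^-1 by rewrite invr_ge0 ltW.
rewrite -!sq -!powRM ?powR_ge0 ?(ltW A1) ?(ltW A2) // -!poweR_EFin; split.
  apply: gt0_ler_poweR => //; rewrite in_itv /= leey andbT //.
    by rewrite lee_fin mulr_ge0 ?powR_ge0 // ltW.
  by apply: integral_ge0 => t _; rewrite lee_fin powR_ge0.
apply: gt0_ler_poweR => //; rewrite in_itv /= leey andbT //.
  by apply: integral_ge0 => t _; rewrite lee_fin powR_ge0.
by rewrite lee_fin mulr_ge0 ?powR_ge0 // ltW.
Qed.

End Embedding.

(** * From L_1 maps to cut metrics *)
Section Esum.
Variable R : realType.
Local Open Scope ereal_scope.

Lemma esum_bool (a : bool -> \bar R) : (forall b, 0 <= a b) ->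
  \esum_(b in [set: bool]) a b = a true + a false.
Proof.
move=> a0; rewrite (esumID [set true]) // !setTI.
have -> : ~` [set true] = [set false] by apply/seteqP; split => -[] //= /(_ erefl).
by rewrite !esum_set1.
Qed.

Lemma esum_pair (A B : choiceType) (a : A -> B -> \bar R) :
  (forall i j, 0 <= a i j) ->
  \esum_(k in [set: A * B]) a k.1 k.2
  = \esum_(i in [set: A]) \esum_(j in [set: B]) a i j.
Proof.
by move=> a0; rewrite esum_esum //; congr esum; apply/seteqP; split.
Qed.

Lemma esum_sumtype (A B : choiceType) (a : A + B -> \bar R) :
  (forall k, 0 <= a k) ->
  \esum_(k in [set: A + B]) a k
  = \esum_(i in [set: A]) a (inl i) + \esum_(j in [set: B]) a (inr j).
Proof.
move=> a0; rewrite (esumID (range (@inl A B))) // !setTI.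
have -> : ~` range (@inl A B) = range (@inr A B).
  apply/seteqP; split => [[i|j]|k [j _ <-] [i]] //=; first by case; exists i.
  by exists j.
by rewrite !esum_image // => ? ? _ _ [].
Qed.

End Esum.

Section CutMetric.
Variables (R : realType) (X : Type).
Local Notation P := (lebesgue01 R).

Lemma sepxx (E : X -> R -> bool) x : sep E x x = set0.
Proof. by apply/seteqP; split => w //=; rewrite /sep /= eqxx. Qed.

Lemma le_lebesgue01 (A B : set R) : measurable A -> measurable B -> A `<=` B ->
  (P A <= P B)%E.
Proof. by move=> mA mB AB; apply: le_measure; rewrite ?inE. Qed.

Lemma le_cut_metricD (J : choiceType) (E : J -> X -> R -> bool) x y z :
  (forall j x, measurable [set w | E j x w]) ->
  (cut_metric E x z <= cut_metric E x y + cut_metric E y z)%E.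
Proof.
move=> mE; rewrite /cut_metric -esumD //; apply: le_esum => j _.
have mS u v : measurable (sep (E j) u v) by exact: measurable_sep.
apply: (@le_trans _ _ (P (sep (E j) x y `|` sep (E j) y z))).
  apply: le_lebesgue01 => //; first exact: measurableU.
  move=> w; rewrite /sep /=; case: (E j x w) (E j y w) (E j z w) => [] [] [] //; by [left|right].
exact: (@measureU2 _ _ _ P _ _ (mS x y) (mS y z)).
Qed.

Lemma cut_metric_reindex (J : choiceType) (e : J -> nat) (E : J -> X -> R -> bool) :
  injective e -> (forall j x, measurable [set w | E j x w]) ->
  exists E' : nat -> X -> R -> bool,
    (forall k x, measurable [set w | E' k x w]) /\
    (forall x y, cut_metric E' x y = cut_metric E x y).
Proof.
move=> inj_e mE.
pose E' k x w := if pselect (exists j, e j = k) is left h then E (sval (cid h)) x w else false.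
have E'e j : E' (e j) = E j.
  rewrite /E'; apply/funext => x; apply/funext => w; case: pselect => [h|[]]; last by exists j.
  by congr E; apply: inj_e; case: (cid h).
have E'n k : ~ (exists j, e j = k) -> forall x w, E' k x w = false.
  by move=> h x w; rewrite /E'; case: pselect.
exists E'; split => [k x|x y].
  have [[j <-]|h] := pselect (exists j, e j = k); first by rewrite E'e.
  by under eq_set do rewrite E'n //; rewrite (_ : mkset _ = set0) //; apply/seteqP; split.
rewrite /cut_metric (esumID (range e)) // setTI [X in (_ + X)%E]esum1 ?adde0; last first.
  move=> k [_ /= h]; have -> : sep (E' k) x y = set0.
    by apply/seteqP; split => w //=; rewrite /sep /= !E'n ?eqxx // => -[j jk]; apply: h; exists j.
  exact: measure0.
rewrite esum_image; last by move=> i j _ _; exact: inj_e.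
by apply: eq_esum => j _; rewrite E'e.
Qed.

End CutMetric.

Section Rounding.
Variables (R : realType).
Local Notation P := (lebesgue01 R).

Lemma sum_ltn_neq (N a b : nat) :
  (\sum_(n < N) ((n < a) != (n < b)) =
  maxn (minn a N) (minn b N) - minn (minn a N) (minn b N))%N.
Proof.
elim: N => [|N IHN]; first by rewrite big_ord0; lia.
by rewrite big_ord_recr /= IHN; case: (ltnP N a) (ltnP N b) => [] ? [] ? /=; lia.
Qed.

Lemma nneseries_ltn_neq (a b : nat) :
  (\sum_(n <oo) (((n < a)%N != (n < b)%N)%:R : R)%:E = (`|a%:R - b%:R|)%:E)%E.
Proof.
apply: lim_near_cst => //; near=> N.
have aN : (a <= N)%N by near: N; exists a.
have bN : (b <= N)%N by near: N; exists b.
rewrite sumEFin big_mkord -natr_sum sum_ltn_neq; congr EFin.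
have -> : minn a N = a by lia.
have -> : minn b N = b by lia.
have [ab|ba] := leqP a b.
  by rewrite natrB // distrC ger0_norm // subr_ge0 ler_nat.
by rewrite natrB 1?ltnW // ger0_norm // subr_ge0 ler_nat ltnW.
Unshelve. all: by end_near.
Qed.

(** Truncation of the positive and negative parts rounds toward 0, hence moves a
    real by less than 1. *)
Lemma trunc_dist (u v : R) (d := `|(Num.trunc u)%:R - (Num.trunc v)%:R| +
    `|(Num.trunc (- u))%:R - (Num.trunc (- v))%:R| : R) :
  `|u - v| <= d + 2 /\ d <= `|u - v| + 2.
Proof.
have tr0 (x : R) : 0 <= x -> Num.trunc (- x) = 0%N.
  by move=> x0; apply/truncn0Pn; rewrite -ltNge; lra.
have tri (x : R) : 0 <= x -> exists2 n : R, (Num.trunc x)%:R = n & n <= x < n + 1.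
  by move=> x0; exists (Num.trunc x)%:R => //; rewrite natr1 truncn_itv.
have [u0|u0] := leP 0 u; have [v0|v0] := leP 0 v; rewrite /d.
- have [n -> /andP[n1 n2]] := tri _ u0; have [m -> /andP[m1 m2]] := tri _ v0.
  rewrite !tr0 // subrr normr0 addr0; case: (ger0P (u - v)); case: (ger0P (n - m)); split; lra.
- have nv : 0 <= - v by lra.
  have [n -> /andP[n1 n2]] := tri _ u0; have [m -> /andP[m1 m2]] := tri _ nv.
  rewrite (tr0 u) // -[v]opprK (tr0 (- v)) // opprK sub0r subr0.
  case: (ger0P (u - v)); case: (ger0P n); case: (ger0P (- m)); split; lra.
- have nu : 0 <= - u by lra.
  have [n -> /andP[n1 n2]] := tri _ nu; have [m -> /andP[m1 m2]] := tri _ v0.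
  rewrite (tr0 v) // -[u]opprK (tr0 (- u)) // opprK sub0r subr0.
  case: (ger0P (u - v)); case: (ger0P n); case: (ger0P (- m)); split; lra.
- have nu : 0 <= - u by lra.
  have nv : 0 <= - v by lra.
  have [n -> /andP[n1 n2]] := tri _ nu; have [m -> /andP[m1 m2]] := tri _ nv.
  rewrite -[u]opprK -[v]opprK (tr0 _ nu) (tr0 _ nv) !opprK subrr normr0 add0r.
  case: (ger0P (u - v)); case: (ger0P (n - m)); split; lra.
Qed.

Variables (X : Type) (f : X -> R -> R).
Hypothesis mf : forall x, measurable_fun setT (f x).

(** Superlevel sets of the truncated positive (true) and negative (false) part
    of f x. *)
Definition level_cut (ns : nat * bool) (x : X) (w : R) : bool :=
  (ns.1 < Num.trunc (if ns.2 then f x w else - f x w))%N.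

Lemma measurable_level_cut ns x : measurable [set w | level_cut ns x w].
Proof.
rewrite /level_cut; case: ns => n s /=.
have mg : measurable_fun setT (fun w => if s then f x w else - f x w).
  by case: s => //; exact: measurableT_comp (mf x).
under eq_set do rewrite truncn_gt_nat.
have := measurable_fun_ler (f := cst (n.+1%:R : R)) (measurable_cst _) mg.
by move=> /(_ measurableT [set true]) /=; rewrite setTI; apply.
Qed.

(** At each w, the number of levels that separate x from y is the distance of
    the rounded values of f x w and f y w. The additive 2 comes from rounding,
    as the total mass is 1. *)
Lemma level_cut_metric x y :
  (\int[P]_w (`|f x w - f y w|)%:E <= cut_metric level_cut x y + 2%:E)%E /\
  (cut_metric level_cut x y <= \int[P]_w (`|f x w - f y w|)%:E + 2%:E)%E.
Proof.
pose d w : R := `|(Num.trunc (f x w))%:R - (Num.trunc (f y w))%:R| +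
    `|(Num.trunc (- f x w))%:R - (Num.trunc (- f y w))%:R|.
pose h n w : \bar R := (\1_(sep (level_cut (n, true)) x y) w)%:E +
  (\1_(sep (level_cut (n, false)) x y) w)%:E.
have mS ns : measurable (sep (level_cut ns) x y).
  by apply: measurable_sep => z; exact: measurable_level_cut.
have mi ns : measurable_fun setT (fun w => (\1_(sep (level_cut ns) x y) w : R)%:E).
  by apply/measurable_EFinP; exact: measurable_indic.
have mh n : measurable_fun setT (h n) by exact: emeasurable_funD.
have h0 n w : (0 <= h n w)%E by rewrite /h -EFinD lee_fin addr_ge0.
have hd w : (\sum_(n <oo) h n w)%E = (d w)%:E.
  rewrite /h nneseriesD => [|n _|n _]; rewrite ?lee_fin //.
  rewrite /d EFinD -!nneseries_ltn_neq; congr (_ + _)%E; apply: eq_eseriesr => n _;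
    rewrite indicE; congr (_%:R)%:E; congr nat_of_bool; exact: (asboolb (_ != _)).
have cutE : cut_metric level_cut x y = (\int[P]_w (d w)%:E)%E.
  under eq_integral do rewrite -hd.
  rewrite integral_nneseries // /cut_metric.
  rewrite (@esum_pair _ _ _ (fun n s => P (sep (level_cut (n, s)) x y))) //.
    rewrite nneseries_esumT => [|n]; last exact: integral_ge0.
    apply: eq_esum => n _; rewrite esum_bool // ge0_integralD //; last 2 first.
    - exact: mi.
    - exact: mi.
    by rewrite !(@integral_indic _ _ _ P setT measurableT _ (mS _)) !setIT.
rewrite cutE.
have md : measurable_fun setT (fun w => (d w)%:E).
  by under eq_fun do rewrite -hd; apply: ge0_emeasurable_sum => // n w _ _; exact: h0.
have mfg : measurable_fun setT (fun w => (`|f x w - f y w|)%:E).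
  apply/measurable_EFinP; apply: (measurableT_comp (@normr_measurable R setT)).
  exact: measurable_funB.
have d0 w : (0 <= (d w)%:E)%E by rewrite lee_fin addr_ge0.
have I2 : (\int[P]_w (2%:E : \bar R) = 2%:E)%E by rewrite integral_cst // lebesgue01T mule1.
rewrite -[X in (_ <= _ + X)%E /\ _]I2 -[X in _ /\ (_ <= _ + X)%E]I2.
rewrite -!ge0_integralD //; split.
  apply: ge0_le_integral => //; first by apply: emeasurable_funD => //.
  by move=> w _; rewrite -EFinD lee_fin; have [] := trunc_dist (f x w) (f y w).
apply: ge0_le_integral => //; first by apply: emeasurable_funD => //.
by move=> w _; rewrite -EFinD lee_fin; have [] := trunc_dist (f x w) (f y w).
Qed.
End Rounding.

(** * Word lengths *)
Section WordLength.
Variables (Gam : groupType) (S : genset Gam).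
Implicit Types (x y : Gam) (w : seq Gam).

Lemma word_lengthP x : has_word S x (word_length S x).
Proof. by rewrite /word_length; case: ex_minnP => n /asboolP. Qed.

Lemma word_length_le w : word_in S w -> (word_length S (\prod_(s <- w) s)%g <= size w)%N.
Proof.
move=> Sw; rewrite /word_length; case: ex_minnP => n _; apply.
by apply/asboolP; exists w.
Qed.

Lemma word_length1 : word_length S 1%g = 0%N.
Proof.
apply/eqP; rewrite -leqn0.
by have := @word_length_le [::] isT; rewrite big_nil.
Qed.

Lemma word_lengthM x y : (word_length S (x * y)%g <= word_length S x + word_length S y)%N.
Proof.
have [v [<- Sv <-]] := word_lengthP x; have [w [<- Sw <-]] := word_lengthP y.
by rewrite -big_cat -size_cat word_length_le // /word_in all_cat; apply/andP.
Qed.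

Lemma word_lengthV x : (word_length S x^-1%g <= word_length S x)%N.
Proof.
have [w [<- Sw <-]] := word_lengthP x.
have -> : ((\prod_(s <- w) s)^-1 = \prod_(s <- [seq s^-1 | s <- rev w]) s)%g.
  elim: w {Sw} => [|s w IHw]; first by rewrite /= !big_nil invg1.
  by rewrite big_cons invgM IHw rev_cons map_rcons big_rcons.
rewrite -(size_rev w) -(size_map (fun s => s^-1)%g) word_length_le //.
apply/allP => _ /mapP[s + ->]; rewrite mem_rev => /(allP Sw).
by rewrite invgK orbC.
Qed.

Lemma word_length_eq0 x : (word_length S x == 0%N) = (x == 1%g).
Proof.
apply/eqP/eqP => [x0|->]; last exact: word_length1.
have [w [sw _ <-]] := word_lengthP x; move/eqP: sw.
by rewrite x0 size_eq0 => /eqP ->; rewrite big_nil.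
Qed.

Lemma word_dist_gt0 x y : (0 < word_dist S x y)%N = (x != y).
Proof.
rewrite lt0n word_length_eq0; congr negb; apply/eqP/eqP => [h|->]; last exact: mulVg.
by apply: (mulgI x^-1)%g; rewrite h mulVg.
Qed.

Lemma word_distC x y : word_dist S x y = word_dist S y x.
Proof.
have h u v : (word_dist S u v <= word_dist S v u)%N.
  have -> : word_dist S u v = word_length S (v^-1 * u)^-1%g.
    by rewrite invgM invgK.
  exact: word_lengthV.
by apply/eqP; rewrite eqn_leq !h.
Qed.

Lemma word_dist_triangle x y z : (word_dist S x z <= word_dist S x y + word_dist S y z)%N.
Proof.
rewrite /word_dist.
have -> : (x^-1 * z = (x^-1 * y) * (y^-1 * z))%g by rewrite -mulgA mulVKg.
exact: word_lengthM.
Qed.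

Definition letters : seq Gam := gens S ++ [seq s^-1%g | s <- gens S].

Lemma mem_letters s : (s \in letters) = (s \in gens S) || (s^-1%g \in gens S).
Proof.
rewrite mem_cat; congr (_ || _); apply/mapP/idP => [[t tS ->]|h]; first by rewrite invgK.
by exists s^-1%g; rewrite ?invgK.
Qed.

Lemma word_inE w : word_in S w = all (mem letters) w.
Proof. by apply: eq_all => s; rewrite /= mem_letters. Qed.

(** An element is encoded by the positions, in the alphabet, of the letters of a
    word that represents it. *)
Lemma genset_countable : exists e : Gam -> nat, injective e.
Proof.
have /choice[w wP] x : exists w, word_in S w /\ (\prod_(s <- w) s)%g = x.
  by have [w Sw wx] := gensP S x; exists w.
exists (fun x => choice.pickle ([seq index s letters | s <- w x] : seq nat)) => x y.
move=> /(pcan_inj choice.pickleK) xy.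
have wK x' : w x' = [seq nth 1%g letters i | i <- [seq index s letters | s <- w x']].
  rewrite -map_comp map_id_in // => s sw /=; rewrite nth_index //.
  by have [+ _] := wP x'; rewrite word_inE => /allP/(_ s sw).
by rewrite -(wP x).2 -(wP y).2 wK xy -wK.
Qed.

(** Balls are finite, because each of them is obtained from the previous one by
    multiplication by the finitely many letters. *)
Lemma infinite_word_length : infinite_set [set: Gam] ->
  forall n, exists x, (n < word_length S x)%N.
Proof.
move=> infG n; apply: contrapT => h; apply: infG.
have ball k : finite_set [set x | (word_length S x <= k)%N].
  elim: k => [|k IHk].
    apply: (@sub_finite_set _ _ [set 1%g]) => // x /=.
    by rewrite leqn0 word_length_eq0 => /eqP.
  apply: (@sub_finite_set _ _ (setT `&` [set x | (word_length S x <= k)%N] `|`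
    [set (a * b)%g | a in [set x | (word_length S x <= k)%N] & b in [set` letters]])).
    move=> x /=; have [w [sw Sw wx]] := word_lengthP x.
    rewrite -{1}sw; case/lastP: w sw Sw wx => [|w s] sw Sw wx.
      by move=> _; left; split => //; rewrite -sw.
    rewrite size_rcons ltnS => wk; right.
    move: Sw; rewrite word_inE all_rcons => /andP[sl wl].
    exists (\prod_(t <- w) t)%g; first by rewrite (leq_trans (word_length_le _)) // word_inE.
    by exists s => //; rewrite -wx big_rcons.
  rewrite setTI finite_setU; split => //; apply: finite_image2 => //.
apply: sub_finite_set (ball n) => x _ /=.
by rewrite leqNgt; apply/negP => nx; apply: h; exists x.
Qed.

Lemma lipschitz_on_letters (R : realType) (psi : Gam -> Gam -> \bar R) (C : R) :
  (forall x, psi x x = 0%E) -> (forall x y z, psi x z <= psi x y + psi y z)%E ->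
  (forall x s, s \in letters -> (psi x (x * s)%g <= C%:E)%E) ->
  forall x y, (psi x y <= (C * (word_dist S x y)%:R)%:E)%E.
Proof.
move=> psi0 psiD psiC x y.
have [w [sw Sw wxy]] := word_lengthP (x^-1 * y)%g.
have -> : y = (x * \prod_(s <- w) s)%g by rewrite wxy mulVKg.
rewrite /word_dist mulKg [in leRHS]wxy -sw.
elim: w x Sw {wxy sw} => [|s w IHw] x' /=; first by rewrite big_nil mulg1 psi0 mulr0.
rewrite word_inE /= => /andP[sl wl]; rewrite big_cons mulgA.
apply: (le_trans (psiD _ (x' * s)%g _)).
rewrite -natr1 mulrDr mulr1 [C * _ + C]addrC EFinD; apply: leeD.
  by apply: psiC; rewrite mem_letters.
by apply: IHw; rewrite word_inE.
Qed.

End WordLength.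

(** Any homomorphism is Lipschitz; for the inclusions of G and H this takes care
    of an arbitrary generating set of the wreath product. *)
Lemma word_length_morphism (H Gam : groupType) (T : genset H) (U : genset Gam)
    (phi : H -> Gam) : phi 1%g = 1%g -> {morph phi : x y / (x * y)%g} ->
  exists M : nat, forall x, (word_length U (phi x) <= M * word_length T x)%N.
Proof.
move=> phi1 phiM.
pose M := \max_(t <- letters T) word_length U (phi t).
exists M => x; have [w [sw Sw wx]] := word_lengthP T x.
rewrite -sw -wx; move: Sw; rewrite word_inE.
elim: w {sw wx} => [|s w IHw] /=; first by rewrite big_nil phi1 word_length1.
move=> /andP[sl /IHw wM]; rewrite big_cons phiM mulnS.
rewrite (leq_trans (word_lengthM _ _ _)) // leq_add //.
exact: (leq_bigmax_seq (F := fun t => word_length U (phi t))).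
Qed.

(** * Cuts of the wreath product *)
Section Fibers.
Variable R : realType.
Local Notation P := (lebesgue01 R).

Lemma esum_fiber (L : choiceType) (e : L -> nat) (rho : R -> L) (A : set R) :
  injective e -> (forall h, measurable [set w | rho w == h]) -> measurable A ->
  \esum_(h in [set: L]) P (A `&` [set w | rho w == h]) = P A.
Proof.
move=> inj_e mrho mA.
pose F k := A `&` [set w | e (rho w) == k].
have Fe h : F (e h) = A `&` [set w | rho w == h].
  by rewrite /F; congr (_ `&` _); apply/seteqP; split => w /=; rewrite inj_eq.
have Fn k : ~ range e k -> F k = set0.
  by move=> nk; apply/seteqP; split => // w [_ /= /eqP wk]; apply: nk; exists (rho w).
have mF k : measurable (F k).
  have [[h _ <-]|/Fn ->] := pselect (range e k); last exact: measurable0.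
  by rewrite Fe; exact: measurableI.
have -> : P A = P (\bigcup_k F k).
  congr (P _); apply/seteqP; split => [w Aw|w [k _ []] //].
  by exists (e (rho w)) => //; split => /=.
rewrite (@measure_semi_bigcup _ _ _ P) //.
- rewrite nneseries_esumT // (esumID (range e)) // setTI [X in (_ + X)%E]esum1 ?adde0.
    rewrite esum_image; last by move=> i j _ _; exact: inj_e.
    by apply: eq_esum => h _; rewrite Fe.
  by move=> k [_ /= /Fn ->]; exact: measure0.
- apply/trivIsetP => i j _ _ ij; apply/seteqP.
  by split => // w [] [_ /= /eqP wi] [_ /= /eqP wj]; rewrite -wi -wj eqxx in ij.
- by apply: bigcup_measurable => k _; exact: mF.
Qed.

Lemma measurable_bool_comp (q : bool -> bool) (A : R -> bool) :
  measurable [set w | A w] -> measurable [set w | q (A w)].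
Proof.
move=> mA; have [qt|qt] := boolP (q true); have [qf|qf] := boolP (q false).
- by rewrite (_ : mkset _ = setT) //; apply/seteqP; split => w //= _; case: (A w).
- rewrite (_ : mkset _ = [set w | A w]) //; apply/seteqP; split => w /=; case: (A w) => //.
  by rewrite (negPf qf).
- rewrite (_ : mkset _ = ~` [set w | A w]); first exact: measurableC.
  by apply/seteqP; split => w /=; case: (A w) => //; rewrite (negPf qt).
- rewrite (_ : mkset _ = set0) //; apply/seteqP; split => w //=.
  by case: (A w); [rewrite (negPf qt)|rewrite (negPf qf)].
Qed.

Lemma measurable_all (T : Type) (s : seq T) (A : T -> R -> bool) :
  (forall t, measurable [set w | A t w]) -> measurable [set w | all (A^~ w) s].
Proof.
move=> mA; elim: s => [|t s IHs] /=.
  by rewrite (_ : mkset _ = setT) //; apply/seteqP; split.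
rewrite (_ : mkset _ = [set w | A t w] `&` [set w | all (A^~ w) s]).
  exact: measurableI.
by apply/seteqP; split => w /=; [move/andP|move=> [? ?]; apply/andP].
Qed.

End Fibers.

Section WreathCuts.
Variables (R : realType) (G H : groupType) (JG JH : choiceType).
Variables (EG : JG -> G -> R -> bool) (EH : JH -> H -> R -> bool).
Hypothesis mEG : forall i x, measurable [set w | EG i x w].
Hypothesis mEH : forall i x, measurable [set w | EH i x w].
Variable eL : {fsfun H -> G with 1%g} -> nat.
Hypothesis inj_eL : injective eL.
Local Notation P := (lebesgue01 R).
Local Notation lamps := ({fsfun H -> G with 1%g}).
Local Notation W := (wreath G H).

(** The part of the lamp configuration f on the side of the cut opposite to b. *)
Definition trace (i : JH) (b : bool) (f : lamps) (w : R) : lamps :=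
  [fsfun z in finsupp f => if EH i z w == b then 1%g else f z].

Lemma traceE i b f w z : trace i b f w z = if EH i z w == b then 1%g else f z.
Proof.
by rewrite fsfunE; case: ifPn => // /fsfun_dflt ->; case: ifP.
Qed.

Lemma measurable_trace i b f h : measurable [set w | trace i b f w == h].
Proof.
pose A z w := (if EH i z w == b then 1%g else f z) == h z.
have -> : [set w | trace i b f w == h] =
    [set w | all (A^~ w) (enum_fset (finsupp f) ++ enum_fset (finsupp h))].
  apply/seteqP; split => w /=.
    by move=> /eqP hE; apply/allP => z _; rewrite /= /A -traceE hE.
  move=> /allP hA; apply/eqP/fsfunP => z; rewrite traceE.
  have [zs|] := boolP (z \in enum_fset (finsupp f) ++ enum_fset (finsupp h)).
    exact/eqP/hA.
  by rewrite mem_cat negb_or => /andP[zf zh]; rewrite !fsfun_dflt //; case: ifP.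
apply: measurable_all => z.
exact: (measurable_bool_comp (fun c => (if c == b then 1%g else f z) == h z) (mEH i z)).
Qed.

Definition wreath_index : choiceType := (((JH * bool) * lamps) + (JG * H))%type.

(** In the first kind of cut the cursor lies on side b and the lamps on the other
    side are those of h. The configuration h has to vanish on side b, and the
    cuts with other h are empty for the given w. *)
Definition wreath_cut (j : wreath_index) (a : W) (w : R) : bool :=
  match j with
  | inl (i, b, h) => (EH i a.2 w == b) && (trace i b a.1 w == h)
  | inr (i, z) => EG i (a.1 z) w
  end.

Lemma measurable_wreath_cut j a : measurable [set w | wreath_cut j a w].
Proof.
case: j => [[[i b] h]|[i z]] /=; last exact: mEG.
rewrite (_ : mkset _ = [set w | EH i a.2 w == b] `&` [set w | trace i b a.1 w == h]).
  apply: measurableI; last exact: measurable_trace.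
  exact: (measurable_bool_comp (fun c => c == b) (mEH i _)).
by apply/seteqP; split => w /=; [move/andP|move=> [? ?]; apply/andP].
Qed.

Definition cursor_metric (a a' : W) : \bar R :=
  \esum_(i in [set: JH]) \esum_(b in [set: bool]) \esum_(h in [set: lamps])
    P (sep (wreath_cut (inl (i, b, h))) a a').

Definition lamp_metric (a a' : W) : \bar R :=
  \esum_(z in [set: H]) cut_metric EG (a.1 z) (a'.1 z).

Lemma wreath_cut_metricE a a' :
  cut_metric wreath_cut a a' = (cursor_metric a a' + lamp_metric a a')%E.
Proof.
rewrite /cut_metric esum_sumtype //; congr (_ + _)%E.
  pose a3 (ib : JH * bool) (h : lamps) := P (sep (wreath_cut (inl (ib.1, ib.2, h))) a a').
  rewrite /cursor_metric -(@esum_pair _ JH bool (fun i b => \esum_(h in setT) a3 (i, b) h)).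
    rewrite (eq_esum (b := fun ib => \esum_(h in setT) a3 ib h)); last by case.
    rewrite -(@esum_pair _ (JH * bool)%type _ a3) //.
    by apply: eq_esum => -[[i b] h].
  by move=> i b; exact: esum_ge0.
rewrite /lamp_metric /cut_metric.
rewrite -(@esum_pair _ _ _ (fun z i => P (sep (EG i) (a.1 z) (a'.1 z)))) //.
rewrite (reindex_esum [set: JG * H] _ (fun k => (k.2, k.1))); last first.
  by split => //= [[i z] [j t] _ _ [-> ->]//|[z i] _]; exists (i, z).
by apply: eq_esum => -[i z] _.
Qed.

(** If the cut of H separates x from x', then for each side b exactly one h
    gives a separating cut, namely the trace of f. If it does not, no h does. *)
Lemma wreath_cut_move f x x' :
  (cut_metric wreath_cut ((f, x) : W) ((f, x') : W) = 2%:E * cut_metric EH x x')%E.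
Proof.
rewrite wreath_cut_metricE [X in (_ + X)%E]esum1 ?adde0; last first.
  by move=> z _; apply: esum1 => i _; rewrite sepxx measure0.
have -> : (2%:E * cut_metric EH x x' = cut_metric EH x x' + cut_metric EH x x')%E.
  by rewrite mule_natl mule2n.
rewrite -esumD //; apply: eq_esum => i _; rewrite esum_bool; last by move=> b; exact: esum_ge0.
have E b : \esum_(h in [set: lamps])
    P (sep (wreath_cut (inl (i, b, h))) ((f, x) : W) ((f, x') : W)) = P (sep (EH i) x x').
  rewrite -(@esum_fiber R _ eL (trace i b f) (sep (EH i) x x')) //.
  - apply: eq_esum => h _; congr (P _); apply/seteqP; split => w /=; rewrite /sep /=.
      case: (trace _ _ _ _ == h); rewrite ?andbT ?andbF //.
      by case: (EH i x w) (EH i x' w) b => [] [] [].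
    move=> [+ ->]; rewrite !andbT.
    by case: (EH i x w) (EH i x' w) b => [] [] [].
  - exact: measurable_trace.
  - exact: measurable_sep.
by rewrite !E.
Qed.

(** The lamp at the cursor lies on the same side as the cursor, where traces
    are blank. *)
Lemma wreath_cut_switch (f f' : lamps) x : (forall z, z != x -> f z = f' z) ->
  cut_metric wreath_cut ((f, x) : W) ((f', x) : W) = cut_metric EG (f x) (f' x).
Proof.
move=> ff'; rewrite wreath_cut_metricE [X in (X + _)%E]esum1 ?add0e; last first.
  move=> i _; apply: esum1 => b _; apply: esum1 => h _.
  rewrite (_ : sep _ _ _ = set0) ?measure0 //; apply/seteqP; split => w //=.
  rewrite /sep /=; have [xb|//] := @eqP _ (EH i x w) b.
  rewrite (_ : trace i b f w = trace i b f' w) ?eqxx //; apply/fsfunP => z.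
  rewrite !traceE; case: eqP => // zb; apply: ff'.
  by apply: contra_notN zb => /eqP ->.
rewrite /lamp_metric (esumID [set x]); last by move=> z _; exact: esum_ge0.
rewrite !setTI [X in (_ + X)%E]esum1 ?adde0; last first.
  by move=> z /= /eqP zx; rewrite ff' //; apply: esum1 => i _; rewrite sepxx measure0.
by rewrite esum_set1 //; exact: esum_ge0.
Qed.

(** Let b be the side of x, and let the cut separate x from z. The cut with h the
    trace of f contains (f, x). If it contained (g, y), then y would be on side
    b, so z <> y, and f and g would have the same trace, so f z = g z. *)
Lemma wreath_cut_ge_range (f g : lamps) x y z : z = y \/ f z <> g z ->
  (cut_metric EH x z <= cut_metric wreath_cut ((f, x) : W) ((g, y) : W))%E.
Proof.
move=> zP; rewrite wreath_cut_metricE.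
have l0 : (0 <= lamp_metric ((f, x) : W) ((g, y) : W))%E.
  by apply: esum_ge0 => t _; exact: esum_ge0.
apply: (le_trans _ (leeDl _ l0)); apply: le_esum => i _.
rewrite esum_bool; last by move=> b; exact: esum_ge0.
pose S b := sep (EH i) x z `&` [set w | EH i x w == b].
have mS b : measurable (S b).
  apply: measurableI; first exact: measurable_sep.
  exact: (measurable_bool_comp (fun c => c == b) (mEH i _)).
have h b : (P (S b) <= \esum_(h in [set: lamps])
    P (sep (wreath_cut (inl (i, b, h))) ((f, x) : W) ((g, y) : W)))%E.
  rewrite -(@esum_fiber R _ eL (trace i b f) (S b)) //; last exact: measurable_trace.
  apply: le_esum => h _; apply: le_lebesgue01.
  - by apply: measurableI => //; exact: measurable_trace.
  - by apply: measurable_sep => a; exact: measurable_wreath_cut.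
  - move=> w [[xz /= /eqP xb] /eqP fh]; rewrite /sep /= xb fh !eqxx /=.
    move: xz; rewrite /sep /= xb => bz; apply/negP; rewrite eq_sym eqb_id => /andP[/eqP yb /eqP gh].
    case: zP => [zy|]; first by rewrite zy yb eqxx in bz.
    apply; have := congr1 (fun k : lamps => k z) (etrans gh (esym fh)); rewrite !traceE.
    by rewrite eq_sym in bz; rewrite (negPf bz).
apply: (le_trans _ (leeD (h true) (h false))).
apply: (le_trans _ (@measureU2 _ _ _ P _ _ (mS true) (mS false))).
apply: le_lebesgue01; [exact: measurable_sep|exact: measurableU|].
by move=> w wS; rewrite /S /=; case E: (EH i x w); [left|right].
Qed.

Lemma wreath_cut_ge_lamps (a a' : W) (s : seq H) : uniq s ->
  (\sum_(z <- s) cut_metric EG (a.1 z) (a'.1 z) <= cut_metric wreath_cut a a')%E.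
Proof.
move=> us; rewrite wreath_cut_metricE.
have c0 : (0 <= cursor_metric a a')%E.
  by do 3!(apply: esum_ge0 => ? _).
apply: (le_trans _ (leeDr _ c0)); apply: esum_ge; exists [set` s].
  by split => //; exact: finite_seq.
by rewrite fsbig_seq.
Qed.

End WreathCuts.

(** Here s stands for the cut metric, D for the distances from the cursor to the
    stops, and e for the cut distances of the lamps. As each e z is at least 1,
    the sum of the D z over the stops is at most s * s^(1/beta). As each e z is at
    most s, its power 1/gamma is at most e z * s^(1/gamma - 1), so the lamps
    contribute at most s^(1/gamma). *)
Lemma tour_bound (R : realType) (I : eqType) (Q : seq I) (D dl e : I -> R)
    (D0 s alpha beta gamma : R) :
  0 < alpha -> 0 < beta -> 0 < gamma -> gamma <= alpha -> gamma * (1 + beta) <= beta ->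
  1 <= s -> D0 <= s `^ beta^-1 -> {in Q, forall z, D z <= s `^ beta^-1} ->
  {in Q, forall z, [/\ 1 <= e z, 0 <= dl z & dl z `^ alpha <= e z]} ->
  \sum_(z <- Q) e z <= s ->
  \sum_(z <- Q) (2 * D z + dl z) + D0 <= 4 * s `^ gamma^-1.
Proof.
move=> a0 b0 g0 ga gb s1 sD0 sD he hs.
have s0 : 0 < s by exact: lt_le_trans s1.
have gi : beta^-1 + 1 <= gamma^-1.
  rewrite -(ler_pM2l g0) divff ?gt_eqF // -(ler_pM2r b0) mul1r.
  by rewrite -mulrA mulrDl mulVf ?gt_eqF // mul1r.
have b1 : 0 < beta^-1 by rewrite invr_gt0.
have powS (r : R) : 0 < r -> r * r `^ (gamma^-1 - 1) = r `^ gamma^-1.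
  move=> r0; rewrite -[X in X * _ = _](powRr1 (ltW r0)) -powRD ?(gt_eqF r0) ?implybT //.
  by rewrite addrC subrK.
have e_le : {in Q, forall z, e z <= s}.
  move=> z zQ; apply: le_trans hs; rewrite (big_rem z) //= lerDl.
  rewrite big_seq sumr_ge0 // => t /mem_rem tQ.
  by have [/(le_trans ler01)] := he t tQ.
have term : {in Q, forall z, 2 * D z + dl z <= e z * (2 * s `^ beta^-1 + s `^ (gamma^-1 - 1))}.
  move=> z zQ; have [e1 d0 de] := he z zQ; rewrite mulrDr.
  have e0 : 0 < e z by exact: lt_le_trans e1.
  apply: lerD.
    apply: (@le_trans _ _ (1 * (2 * s `^ beta^-1))); first by rewrite mul1r ler_pM2l ?sD.
    by rewrite ler_wpM2r // mulr_ge0 ?powR_ge0.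
  have h1 : dl z <= e z `^ alpha^-1.
    have : (dl z `^ alpha) `^ alpha^-1 <= e z `^ alpha^-1.
      by apply: ge0_ler_powR; rewrite ?nnegrE ?powR_ge0 ?invr_ge0 // ltW.
    by rewrite -powRrM mulfV ?gt_eqF // powRr1.
  apply: (le_trans h1); apply: (@le_trans _ _ (e z `^ gamma^-1)).
    by rewrite ler_powR // lef_pV2.
  rewrite -powS // ler_pM2l //; apply: ge0_ler_powR; rewrite ?nnegrE ?(ltW e0) ?(ltW s0) ?e_le //.
  lra.
have -> : 4 * s `^ gamma^-1 = s * (2 * s `^ (gamma^-1 - 1) + s `^ (gamma^-1 - 1)) + s `^ gamma^-1.
  by rewrite -powS //; ring.
apply: lerD; last by rewrite (le_trans sD0) // ler_powR //; lra.
rewrite big_seq; apply: (le_trans (ler_sum _ term)); rewrite -big_seq -mulr_suml.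
apply: (@le_trans _ _ (s * (2 * s `^ beta^-1 + s `^ (gamma^-1 - 1)))).
  by rewrite ler_wpM2r // addr_ge0 ?mulr_ge0 ?powR_ge0.
rewrite ler_pM2l // lerD2r ler_pM2l // ler_powR //; lra.
Qed.

Section WreathTour.
Variables (G H : groupType) (S : genset G) (T : genset H) (U : genset (wreath G H)).
Local Notation lamps := ({fsfun H -> G with 1%g}).
Local Notation W := (wreath G H).

Lemma wreath_baseE (f : lamps) (x y : H) :
  (((f, x) : W) * wreath_base G y)%g = ((f, x * y)%g : W).
Proof.
by apply: wreath_eqP => // z; rewrite wreath_mulE /= fsfunE mulg1.
Qed.

(** The cursor goes to z, replaces the lamp there by u, and returns. *)
Lemma wreath_switchE (f : lamps) (x z : H) (u : G) :
  (((f, x) : W) * wreath_base G (x^-1 * z) * wreath_lamp H ((f z)^-1 * u)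
    * wreath_base G (z^-1 * x))%g = (([fsfun f with z |-> u], x) : W).
Proof.
rewrite wreath_baseE mulVKg; apply: wreath_eqP => [t|]; last first.
  by rewrite /= mulg1 mulVKg.
rewrite 2!wreath_mulE /= wreath_deltaE fsfunE mulg1 fsfun_withE.
rewrite -(inj_eq (mulgI z)) mulVKg mulg1; case: eqP => [->|_]; last by rewrite mulg1.
by rewrite mulVKg.
Qed.

Lemma wreath_word_dist : exists M : nat, forall (f g : lamps) (x y : H) (s : seq H),
  uniq s -> (forall z, f z <> g z -> z \in s) ->
  (word_dist U ((f, x) : W) ((g, y) : W) <=
   M * (\sum_(z <- s) (2 * word_dist T x z + word_dist S (f z) (g z)) + word_dist T x y))%N.
Proof.
have [M1 hM1] := word_length_morphism T U (wreath_base1 G H) (@wreath_baseM G H).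
have [M2 hM2] := word_length_morphism S U (wreath_lamp1 G H) (@wreath_lampM G H).
pose M := (M1 + M2)%N; exists M => f g x y s.
have move_le f' x' y' : (word_dist U ((f', x') : W) ((f', y') : W) <= M * word_dist T x' y')%N.
  have -> : ((f', y') : W) = (((f', x') : W) * wreath_base G (x'^-1 * y'))%g.
    by rewrite wreath_baseE mulVKg.
  rewrite /word_dist mulKg (leq_trans (hM1 _)) // leq_mul2r leq_addr orbT //.
have switch_le f' z u : (word_dist U ((f', x) : W) (([fsfun f' with z |-> u], x) : W)
    <= M * (2 * word_dist T x z + word_dist S (f' z) u))%N.
  rewrite -wreath_switchE /word_dist -!mulgA mulKg.
  rewrite (leq_trans (word_lengthM _ _ _)) //.
  have h2 := leq_trans
    (word_lengthM U (wreath_lamp H ((f' z)^-1 * u)%g) (wreath_base G (z^-1 * x)%g))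
    (leq_add (hM2 _) (hM1 _)).
  have h3 := leq_add (hM1 (x^-1 * z)%g) h2.
  apply: (leq_trans h3).
  have e : word_length T (z^-1 * x)%g = word_length T (x^-1 * z)%g by exact: (word_distC T z x).
  by rewrite e /M; nia.
elim: s f => [|z s IHs] f.
  move=> _ fg; have -> : f = g.
    by apply/fsfunP => z; apply: contrapT => /fg; rewrite in_nil.
  by rewrite big_nil add0n; exact: move_le.
move=> /= /andP[zs us] fg; rewrite big_cons.
have f's t : [fsfun f with z |-> g z] t <> g t -> t \in s.
  rewrite fsfun_withE; case: eqP => [->//|/eqP tz] /fg.
  by rewrite in_cons (negPf tz).
have := IHs _ us f's; rewrite big_seq.
have -> : (\sum_(i <- s | i \in s)
             (2 * word_dist T x i + word_dist S ([fsfun f with z |-> g z] i) (g i)) =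
           \sum_(i <- s) (2 * word_dist T x i + word_dist S (f i) (g i)))%N.
  rewrite [RHS]big_seq; apply: eq_bigr => t ts; rewrite fsfun_withE.
  by case: eqP => // tz; rewrite tz (negPf zs) in ts.
move=> IH; apply: (leq_trans (word_dist_triangle U _ (([fsfun f with z |-> g z], x) : W) _)).
apply: (leq_trans (leq_add (switch_le f z (g z)) IH)).
by rewrite -mulnDr leq_mul2l addnA leqnn orbT.
Qed.

End WreathTour.

(** The real-valued function psi names the cut metric, which takes values in the
    extended reals. *)
Definition cut_compression (R : realType) (Gam : groupType) (S : genset Gam)
    (J : choiceType) (E : J -> Gam -> R -> bool) (psi : Gam -> Gam -> R)
    (C alpha : R) : Prop :=
  [/\ forall j x, measurable [set w | E j x w],
      forall x y, cut_metric E x y = (psi x y)%:E,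
      forall x y, psi x y <= C * (word_dist S x y)%:R &
      forall x y, x != y -> (word_dist S x y)%:R `^ alpha <= psi x y].

Section Source.
Variables (R : realType) (Gam : groupType) (S : genset Gam).
Local Notation P := (lebesgue01 R).

Lemma le1_word_dist x y : x != y -> 1 <= (word_dist S x y)%:R :> R.
Proof. by rewrite -(word_dist_gt0 S) ler1n. Qed.

Lemma word_distxx x : word_dist S x x = 0%N.
Proof. by rewrite /word_dist mulVg word_length1. Qed.

Lemma powR_ge1 (a b : R) : 1 <= a -> 0 <= b -> 1 <= a `^ b.
Proof.
move=> a1 b0; have := @ge0_ler_powR R b b0 1 a.
by rewrite powR1; apply; rewrite ?nnegrE // (le_trans ler01).
Qed.

(** The factor K makes the L_1 distance at least 3 d^alpha, from which the
    rounding error 2 can be subtracted, as d >= 1 for distinct points. *)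
Lemma cut_metric_of_L1 (alpha : R) (f : Gam -> Lp01 (lexx (1 : R))) :
  0 <= alpha -> Lp_lipschitz S f -> compresses S alpha f ->
  exists (psi : Gam -> Gam -> R) (C : R) (E : nat * bool -> Gam -> R -> bool),
    cut_compression S E psi C alpha.
Proof.
move=> a0 [L fL] [c c0 fc].
pose K := 3 / c; have K0 : 0 < K by rewrite divr_gt0.
pose g x w : R := K * f x w.
have mg x : measurable_fun setT (g x).
  by apply: measurable_funM => //; exact: measurable_Lp01.
have mfg x y : measurable_fun setT (fun w => (`|f x w - f y w|)%:E).
  apply/measurable_EFinP; apply: (measurableT_comp (@normr_measurable R setT)).
  by apply: measurable_funB; exact: measurable_Lp01.
have dE x y : Lp01_dist (f x) (f y) = (\int[P]_w (`|f x w - f y w|)%:E)%E.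
  rewrite Lp01_distE invr1 poweRe1; last by apply: integral_ge0 => w _; rewrite lee_fin powR_ge0.
  by apply: eq_integral => w _; rewrite powRr1.
have gE x y : (\int[P]_w (`|g x w - g y w|)%:E = K%:E * Lp01_dist (f x) (f y))%E.
  rewrite dE -ge0_integralZl_EFin ?(ltW K0) //.
  by apply: eq_integral => w _; rewrite /g -mulrBr normrM gtr0_norm // EFinM.
pose psi x y := fine (cut_metric (level_cut g) x y).
have fin x y : cut_metric (level_cut g) x y = (psi x y)%:E.
  rewrite /psi fineK // ge0_fin_numE; last exact: esum_ge0.
  have [_ /le_lt_trans] := level_cut_metric mg x y; apply; rewrite gE.
  apply: (@le_lt_trans _ _ (K%:E * (L * (word_dist S x y)%:R)%:E + 2%:E)%E).
    by apply: leeD => //; apply: lee_wpmul2l => //; rewrite lee_fin ltW.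
  by rewrite -EFinM -EFinD ltry.
exists psi, (K * L + 2), (level_cut g); split.
- by move=> j x; exact: measurable_level_cut.
- exact: fin.
- move=> x y; have [->|xy] := eqVneq x y.
    rewrite word_distxx mulr0 /psi /cut_metric esum1 // => j _.
    by rewrite sepxx measure0.
  rewrite -lee_fin -fin; have [_ /le_trans] := level_cut_metric mg x y; apply.
  apply: (@le_trans _ _ (K%:E * (L * (word_dist S x y)%:R)%:E + 2%:E)%E).
    by apply: leeD => //; rewrite gE; apply: lee_wpmul2l => //; rewrite lee_fin ltW.
  rewrite -EFinM -EFinD lee_fin mulrDl mulrA lerD2l.
  by rewrite ler_peMr // le1_word_dist.
- move=> x y xy.
  have [h _] := level_cut_metric mg x y.
  have /(le_trans (lee_wpmul2l _ (fc x y xy))) :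
      (K%:E * Lp01_dist (f x) (f y) <= (psi x y + 2)%:E)%E.
    by rewrite -gE EFinD -fin.
  rewrite lee_fin ltW // => /(_ isT); rewrite -EFinM lee_fin mulrA divfK ?gt_eqF // => h3.
  have := powR_ge1 (le1_word_dist xy) a0; lra.
Qed.

End Source.

Section WreathCompression.
Variables (R : realType) (G H : groupType).
Variables (S : genset G) (T : genset H) (U : genset (wreath G H)).
Local Notation lamps := ({fsfun H -> G with 1%g}).
Local Notation W := (wreath G H).
Variables (JG JH : choiceType) (EG : JG -> G -> R -> bool) (EH : JH -> H -> R -> bool).
Variables (pG : G -> G -> R) (pH : H -> H -> R) (CG CH alpha beta gamma : R).
Hypotheses (hG : cut_compression S EG pG CG alpha) (hH : cut_compression T EH pH CH beta).
Hypotheses (a0 : 0 < alpha) (b0 : 0 < beta) (g0 : 0 < gamma).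
Hypotheses (ga : gamma <= alpha) (gb : gamma * (1 + beta) <= beta).
Variables (eL : lamps -> nat) (inj_eL : injective eL).
Local Notation E := (wreath_cut EG EH).

Let mEG : forall j x, measurable [set w | EG j x w]. Proof. by case: hG. Qed.
Let mEH : forall j x, measurable [set w | EH j x w]. Proof. by case: hH. Qed.

Let mE j a : measurable [set w | E j a w].
Proof. exact: measurable_wreath_cut. Qed.

(** The cut metric is not left invariant, hence the displacement of a right
    multiplication is bounded uniformly in the starting point. *)
Let bounded_step (u : W) := exists C : R, forall a : W, (cut_metric E a (a * u)%g <= C%:E)%E.

Let bounded_stepM u v : bounded_step u -> bounded_step v -> bounded_step (u * v)%g.
Proof.
move=> [C hC] [D hD]; exists (C + D) => a; rewrite mulgA EFinD.
by apply: le_trans (le_cut_metricD _ (a * u)%g _ mE) _; exact: leeD.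
Qed.

Let bounded_step_base y : bounded_step (wreath_base G y).
Proof.
have [_ pHE pHC _] := hH.
exists (2 * (CH * (word_length T y)%:R)) => -[f x].
rewrite wreath_baseE (wreath_cut_move EG mEH inj_eL) pHE -EFinM lee_fin ler_pM2l //.
by have := pHC x (x * y)%g; rewrite /word_dist mulKg.
Qed.

Let bounded_step_lamp u : bounded_step (wreath_lamp H u).
Proof.
have [_ pGE pGC _] := hG.
exists (CG * (word_length S u)%:R) => -[f x].
pose b := (((f, x) : W) * wreath_lamp H u)%g.
have bE z : b.1 z = if z == x then (f z * u)%g else f z.
  rewrite /b wreath_mulE /= wreath_deltaE -(inj_eq (mulgI x)) mulVKg mulg1.
  by case: ifP; rewrite ?mulg1.
have bx : b = ((b.1, x) : W) by apply: wreath_eqP => //=; rewrite mulg1.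
rewrite -/b bx (wreath_cut_switch EG EH) => [|z /negPf zx]; last by rewrite bE zx.
rewrite pGE lee_fin bE eqxx.
by have := pGC (f x) (f x * u)%g; rewrite /word_dist mulKg.
Qed.

Let bounded_step_all u : bounded_step u.
Proof.
have [w Sw <-] := wreath_generates S T u.
elim: w Sw => [|s w IHw] /=; first by have := bounded_step_base 1%g; rewrite wreath_base1 big_nil.
move=> /andP[sS /IHw wB]; rewrite big_cons; apply: bounded_stepM; last exact: wB.
have gensB t : t \in wreath_gens S T -> bounded_step t /\ bounded_step t^-1%g.
  rewrite in_fsetU => /orP[] /imfsetP[k _ ->]; split.
  - exact: bounded_step_base.
  - by rewrite -wreath_baseV; exact: bounded_step_base.
  - exact: bounded_step_lamp.
  - by rewrite -wreath_lampV; exact: bounded_step_lamp.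
case/orP: sS => /gensB []; first by [].
by rewrite invgK.
Qed.

Lemma wreath_cut_lipschitz : exists2 C : R, 0 <= C &
  forall a b, (cut_metric E a b <= (C * (word_dist U a b)%:R)%:E)%E.
Proof.
have /choice[B hB] : forall u : W, exists C : R, forall a : W, (cut_metric E a (a * u)%g <= C%:E)%E.
  exact: bounded_step_all.
exists (\sum_(u <- letters U) `|B u|); first exact: sumr_ge0.
apply: lipschitz_on_letters.
- by move=> a; apply: esum1 => j _; rewrite sepxx measure0.
- by move=> a b c; exact: le_cut_metricD.
- move=> a u uU; apply: (le_trans (hB u a)); rewrite lee_fin (big_rem u) //=.
  by rewrite (le_trans (ler_norm _)) // lerDl sumr_ge0.
Qed.

(** Comparison of the cut metric s with the tour through the set Q of lamps that
    differ; s >= 1 since distinct elements differ in a lamp or in the cursor. *)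
Lemma wreath_cut_compression : exists (psi : W -> W -> R) (c C : R),
  [/\ 0 < c, 0 <= C, forall a b, cut_metric E a b = (psi a b)%:E,
      forall a b, psi a b <= C * (word_dist U a b)%:R &
      forall a b, a != b -> c * (word_dist U a b)%:R `^ gamma <= psi a b].
Proof.
have [_ pGE pGC pGl] := hG; have [_ pHE pHC pHl] := hH.
have [C C0 hC] := wreath_cut_lipschitz.
pose psi a b := fine (cut_metric E a b).
have psiE a b : cut_metric E a b = (psi a b)%:E.
  rewrite /psi fineK // ge0_fin_numE; last exact: esum_ge0.
  by rewrite (le_lt_trans (hC a b)) // ltry.
have [M hM] := wreath_word_dist S T U.
pose N : R := 4 * M%:R + 1; have N0 : 0 < N by rewrite ltr_wpDl // mulr_ge0.
exists psi, (N `^ gamma)^-1, C; split.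
- by rewrite invr_gt0 powR_gt0.
- exact: C0.
- exact: psiE.
- by move=> a b; rewrite -lee_fin -psiE; exact: hC.
move=> [f x] [g y] ab; set s := psi _ _; set d := (word_dist _ _ _)%:R.
pose Q := undup [seq z <- enum_fset (finsupp f) ++ enum_fset (finsupp g) | f z != g z].
have Qu : uniq Q by exact: undup_uniq.
have QP z : (z \in Q) = (f z != g z).
  rewrite mem_undup mem_filter; case: eqP => //= fg.
  rewrite mem_cat; apply: contraT; rewrite negb_or => /andP[zf zg].
  by case: fg; rewrite !fsfun_dflt.
have Hle z : z = y \/ z \in Q -> x != z -> (word_dist T x z)%:R `^ beta <= s.
  move=> zP xz; apply: (le_trans (pHl x z xz)); rewrite -lee_fin -pHE -psiE.
  apply: (wreath_cut_ge_range mEG mEH inj_eL); case: zP => [->|]; first by left.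
  by rewrite QP => /eqP; right.
have Gsum : \sum_(z <- Q) pG (f z) (g z) <= s.
  rewrite -lee_fin -psiE -sumEFin; under eq_bigr do rewrite -pGE.
  exact: (wreath_cut_ge_lamps EG EH ((f, x) : W) ((g, y) : W) Qu).
have pG1 z : z \in Q -> 1 <= pG (f z) (g z).
  rewrite QP => fg; apply: le_trans (pGl _ _ fg).
  by apply: powR_ge1; [exact: le1_word_dist|exact: ltW].
have s1 : 1 <= s.
  case: (boolP (x == y)) => [/eqP xy|xy]; last first.
    apply: le_trans (Hle y (or_introl erefl) xy).
    by apply: powR_ge1; [exact: le1_word_dist|exact: ltW].
  have [z zQ] : exists z, z \in Q.
    apply: contrapT => h; move/negP: ab; apply; apply/eqP; rewrite xy; congr (_, _).
    by apply/fsfunP => z; apply/eqP; apply: contraT => fg; exfalso; apply: h; exists z; rewrite QP.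
  apply: le_trans Gsum; rewrite (big_rem z) //= (le_trans (pG1 z zQ)) // lerDl.
  by rewrite big_seq sumr_ge0 // => t /mem_rem /pG1/(le_trans ler01).
have s0 : 0 < s by exact: lt_le_trans s1.
have Hle' z : z = y \/ z \in Q -> (word_dist T x z)%:R <= s `^ beta^-1.
  move=> zP; have [->|xz] := eqVneq x z; first by rewrite word_distxx powR_ge0.
  have : ((word_dist T x z)%:R `^ beta) `^ beta^-1 <= s `^ beta^-1.
    by apply: ge0_ler_powR; rewrite ?nnegrE ?powR_ge0 ?invr_ge0 ?(ltW b0) ?(ltW s0) ?Hle.
  by rewrite -powRrM mulfV ?gt_eqF // powRr1.
have dle : d <= N * s `^ gamma^-1.
  have fgQ z : f z <> g z -> z \in Q by move=> /eqP; rewrite QP.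
  have hd := hM f g x y Q Qu fgQ; apply: (@le_trans _ _ (M%:R * (4 * s `^ gamma^-1))).
    move: hd; rewrite -(ler_nat R) natrM natrD natr_sum => /le_trans; apply.
    rewrite ler_wpM2l //; under eq_bigr do rewrite natrD natrM.
    apply: (@tour_bound R H Q _ _ (fun z => pG (f z) (g z)) _ s alpha beta gamma) => //.
    - by apply: Hle'; left.
    - by move=> z zQ; apply: Hle'; right.
    - by move=> z zQ; split; [exact: pG1|exact: ler0n|apply: pGl; rewrite -QP].
  by rewrite mulrA ler_wpM2r ?powR_ge0 // /N mulrC lerDl.
rewrite ler_pdivrMl ?powR_gt0 //.
apply: (@le_trans _ _ ((N * s `^ gamma^-1) `^ gamma)).
  by apply: ge0_ler_powR; rewrite ?nnegrE ?(ltW g0) ?mulr_ge0 ?powR_ge0 ?(ltW N0).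
rewrite powRM ?powR_ge0 ?(ltW N0) // -powRrM mulVf ?gt_eqF // powRr1 ?(ltW s0) //.
Qed.

End WreathCompression.

(** * Compression exponents *)
Section Target.
Variables (R : realType) (X : Type) (E : nat -> X -> R -> bool) (o : X).
Variables (p : R) (p1 : 1 <= p) (psi : X -> X -> R) (e : X -> nat).
Hypotheses (mE : forall k x, measurable [set w | E k x w]).
Hypothesis psiE : forall x y, cut_metric E x y = (psi x y)%:E.
Hypothesis inj_e : injective e.

Lemma embed_cut_metric : exists (F : X -> Lp01 p1) (A B : R),
  [/\ 0 < A, 0 < B,
   forall x y, ((A * psi x y `^ Num.max p^-1 2^-1)%:E <= Lp01_dist (F x) (F y))%E &
   forall x y, (Lp01_dist (F x) (F y) <= (B * psi x y `^ Num.max p^-1 2^-1)%:E)%E].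
Proof.
have p0 : 0 < p by exact: lt_le_trans p1.
have fE x y : (cut_metric E x y < +oo)%E by rewrite psiE ltry.
have psi_fine x y : fine (cut_metric E x y) = psi x y by rewrite psiE.
(* max(1/p, 1/2) is 1/p up to p = 2 and 1/2 beyond *)
have [p2|p2] := leP p 2.
  have [F FE] := embed_snowflake o p1 mE fE.
  have -> : Num.max p^-1 2^-1 = p^-1 by apply/max_idPl; rewrite lef_pV2 ?posrE.
  by exists F, 1, 1; split => // x y; rewrite FE psi_fine mul1r.
have [F [A [A1 A2 FA]]] := embed_hilbert o p1 mE fE inj_e (ltW p2).
have -> : Num.max p^-1 2^-1 = 2^-1 by apply/max_idPr; rewrite lef_pV2 ?posrE // ltW.
by exists F, A.1, A.2; split => // x y; have := FA x y; rewrite psi_fine => -[].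
Qed.

End Target.

Section Exponent.
Variables (R : realType) (p : R) (p1 : 1 <= p) (Gam : groupType) (S : genset Gam).

(** Otherwise c n^alpha <= L n would fail at the elements of large length n. This
    bounds the set of exponents, so that its supremum dominates its members. *)
Lemma compresses_le1 (alpha : R) (f : Gam -> Lp01 p1) : infinite_set [set: Gam] ->
  Lp_lipschitz S f -> compresses S alpha f -> alpha <= 1.
Proof.
move=> infG [L fL] [c c0 fc]; rewrite leNgt; apply/negP => a1.
have b0 : 0 < alpha - 1 by rewrite subr_gt0.
pose B := (Num.max (L / c) 1) `^ (alpha - 1)^-1.
have M0 : 0 < Num.max (L / c) 1 by rewrite lt_max ltr01 orbT.
have [x nx] := infinite_word_length S infG (Num.trunc B).
have dx : word_dist S 1%g x = word_length S x by rewrite /word_dist invg1 mul1g.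
have x1 : 1%g != x by rewrite -(word_dist_gt0 S) dx (leq_ltn_trans _ nx).
have Bx : B < (word_length S x)%:R.
  by rewrite (lt_le_trans (truncnS_gt B)) // ler_nat.
have := le_trans (fc _ _ x1) (fL _ _); rewrite dx lee_fin.
set n := (word_length S x)%:R in Bx *.
have n0 : 0 < n by rewrite (le_lt_trans _ Bx) // powR_ge0.
have -> : n `^ alpha = n * n `^ (alpha - 1).
  by rewrite -[X in X * _](powRr1 (ltW n0)) -powRD ?(gt_eqF n0) ?implybT // addrC subrK.
rewrite mulrCA mulrC ler_pM2r // -ler_pdivlMl // => h.
have : Num.max (L / c) 1 < n `^ (alpha - 1).
  have -> : Num.max (L / c) 1 = B `^ (alpha - 1).
    by rewrite /B -powRrM mulVf ?lt0r_neq0 // powRr1 // ltW.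
  by apply: gt0_ltr_powR => //; rewrite nnegrE ?powR_ge0 // ltW.
by rewrite gt_max mulrC => /andP[/(le_lt_trans h)]; rewrite ltxx.
Qed.

Lemma compression_exponent_ge (alpha : R) (f : Gam -> Lp01 p1) :
  infinite_set [set: Gam] -> 0 <= alpha -> Lp_lipschitz S f -> compresses S alpha f ->
  alpha <= compression_exponent p1 S.
Proof.
move=> infG a0 fL fc; apply: ub_le_sup; last by split => //; exists f.
by exists 1 => b [_ [g [gL gc]]]; exact: compresses_le1 gc.
Qed.

Lemma compression_exponent_ge0 : 0 <= compression_exponent p1 S.
Proof.
rewrite /compression_exponent; set A := [set _ | _].
have [hA|hA] := pselect (has_sup A); last by rewrite sup_out.
have [[a Aa] ubA] := hA; apply: (@le_trans _ _ a); first by case: Aa.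
exact: ub_le_sup.
Qed.

(** The supremum of a set of reals that is empty or unbounded is 0 by convention,
    so a supremum above q >= 0 is genuinely approached. *)
Lemma compression_exponent_gt (q : R) : 0 <= q -> q < compression_exponent p1 S ->
  exists (alpha : R) (f : Gam -> Lp01 p1),
    [/\ q < alpha, Lp_lipschitz S f & compresses S alpha f].
Proof.
move=> q0 qa.
have hs : has_sup [set alpha : R | 0 <= alpha /\
    exists f : Gam -> Lp01 p1, Lp_lipschitz S f /\ compresses S alpha f].
  by apply: contrapT => h; move: qa; rewrite /compression_exponent sup_out // ltNge q0.
have e0 : 0 < compression_exponent p1 S - q by rewrite subr_gt0.
have [alpha [_ [f [fL fc]]]] := sup_adherent e0 hs.
by rewrite subKr => qalpha; exists alpha, f.
Qed.

End Exponent.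

(** The outer power theta = max(1/p, 1/2) is at most 1 and word distances are
    integers, so the theta-th power of a Lipschitz function is Lipschitz. *)
Lemma wreath_compression_ge (R : realType) (G H : groupType)
    (S : genset G) (T : genset H) (U : genset (wreath G H)) (p : R) (p1 : 1 <= p)
    (alpha beta : R) (f : G -> Lp01 (lexx (1 : R))) (g : H -> Lp01 (lexx (1 : R))) :
  0 < alpha -> 0 < beta ->
  Lp_lipschitz S f -> compresses S alpha f ->
  Lp_lipschitz T g -> compresses T beta g ->
  exists F : wreath G H -> Lp01 p1, Lp_lipschitz U F /\
    compresses U (Num.max p^-1 2^-1 * Num.min alpha (beta / (1 + beta))) F.
Proof.
move=> a0 b0 fL fc gL gc.
have [pG [CG [EG hG]]] := cut_metric_of_L1 (ltW a0) fL fc.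
have [pH [CH [EH hH]]] := cut_metric_of_L1 (ltW b0) gL gc.
pose gamma := Num.min alpha (beta / (1 + beta)).
have b1 : 0 < 1 + beta by rewrite addr_gt0.
have g0 : 0 < gamma by rewrite lt_min a0 divr_gt0.
have ga : gamma <= alpha by rewrite ge_min lexx.
have gb : gamma * (1 + beta) <= beta by rewrite -ler_pdivlMr // ge_min lexx orbT.
have [eW inj_eW] := genset_countable (wreath_genset S T).
pose eL (h : {fsfun H -> G with 1%g}) := eW ((h, 1%g) : wreath G H).
have inj_eL : injective eL by move=> h k /inj_eW [].
have [psi [c [C [c0 C0 psiE psiC psil]]]] :=
  wreath_cut_compression U hG hH a0 b0 g0 ga gb inj_eL.
have mE : forall j a, measurable [set w | wreath_cut EG EH j a w].
  by case: hG hH => mEG _ _ _ [mEH _ _ _]; exact: measurable_wreath_cut.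
have [eH inj_eH] := genset_countable T.
pose code (j : wreath_index G H (nat * bool)%type (nat * bool)%type) :
    ((nat * bool) * bool * nat) + ((nat * bool) * nat) :=
  match j with inl (i, b, h) => inl (i, b, eL h) | inr (i, z) => inr (i, eH z) end.
have inj_code : injective code.
  move=> [[[i b] h]|[i z]] [[[j d] k]|[j t]] //=; first by move=> [-> -> /inj_eL ->].
  by move=> [-> /inj_eH ->].
have [E' [mE' E'E]] := cut_metric_reindex
  (inj_comp (pcan_inj (@choice.pickleK _)) inj_code) mE.
have [F [A [B [A0 B0 FA FB]]]] := embed_cut_metric 1%g p1 mE'
  (fun a b => etrans (E'E a b) (psiE a b)) inj_eW.
set theta := Num.max p^-1 2^-1 in FA FB *.
have th0 : 0 < theta by rewrite lt_max invr_gt0 (lt_le_trans ltr01 p1).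
have th1 : theta <= 1.
  by rewrite ge_max invf_le1 ?(lt_le_trans ltr01 p1) // p1 /= invf_le1 // ler1n.
have psi0 a b : 0 <= psi a b by rewrite -lee_fin -psiE; exact: esum_ge0.
exists F; split.
  exists (B * C `^ theta) => a b; apply: (le_trans (FB a b)).
  rewrite lee_fin -mulrA ler_pM2l //.
  apply: (@le_trans _ _ ((C * (word_dist U a b)%:R) `^ theta)).
    by apply: ge0_ler_powR; rewrite ?nnegrE ?mulr_ge0 // ltW.
  rewrite powRM // ler_wpM2l ?powR_ge0 //.
  case: (word_dist U a b) => [|n]; first by rewrite powR0 // gt_eqF.
  by rewrite -[leRHS]powRr1 // ler_powR // ler1n.
exists (A * c `^ theta); first by rewrite mulr_gt0 // powR_gt0.
move=> a b ab; apply: le_trans (FA a b); rewrite lee_fin -mulrA ler_pM2l //.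
rewrite [theta * _]mulrC powRrM -powRM ?powR_ge0 // ?(ltW c0) //.
by apply: ge0_ler_powR; rewrite ?nnegrE ?mulr_ge0 ?powR_ge0 ?(ltW c0) ?(ltW th0) // psil.
Qed.

Theorem theorem1p1 (R : realType) (G H : groupType)
    (infG : infinite_set [set: G]) (infH : infinite_set [set: H])
    (S : genset G) (T : genset H) (U : genset (wreath G H))
    (p : R) (p1 : 1 <= p) :
  let alpha1G := compression_exponent (lexx (1 : R)) S in
  let alpha1H := compression_exponent (lexx (1 : R)) T in
  compression_exponent p1 U
    >= Num.max p^-1 2^-1 * Num.min alpha1G (alpha1H / (1 + alpha1H)).
Proof.
cbv zeta; set aG := compression_exponent _ S; set aH := compression_exponent _ T.
rewrite leNgt; apply/negP.
set theta := Num.max p^-1 2^-1; set q' := compression_exponent p1 U.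
have th0 : 0 < theta by rewrite lt_max invr_gt0 (lt_le_trans ltr01 p1).
have q'0 : 0 <= q' by exact: compression_exponent_ge0.
have aH0 : 0 <= aH by exact: compression_exponent_ge0.
pose q := q' / theta; have q0 : 0 <= q by rewrite divr_ge0 // ltW.
rewrite mulrC -ltr_pdivrMr // -/q lt_min => /andP[qG qH].
have [alpha [f [qa fL fc]]] := compression_exponent_gt q0 qG.
(* q < b / (1 + b) is equivalent to b > q / (1 - q) *)
rewrite ltr_pdivlMr ?addr_ge0 // ?ltr_wpDr // in qH.
have q1 : q < 1 by rewrite ltNge; apply/negP => q1; move: qH; rewrite ltNge; nra.
have qH' : q / (1 - q) < aH by rewrite ltr_pdivrMr ?subr_gt0 //; lra.
have q1' : 0 <= q / (1 - q) by rewrite divr_ge0 // subr_ge0 ltW.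
have [beta [g [qb gL gc]]] := compression_exponent_gt q1' qH'.
have a0 : 0 < alpha by exact: le_lt_trans qa.
have b0 : 0 < beta by exact: le_lt_trans qb.
have [F [FL Fc]] := wreath_compression_ge U p1 a0 b0 fL fc gL gc.
have infW : infinite_set [set: wreath G H].
  move=> finW; apply: infH.
  have := finite_image snd finW; apply: sub_finite_set => x _.
  by exists ((1%g : wreath G H).1, x).
have m0 : 0 <= Num.min alpha (beta / (1 + beta)).
  by rewrite le_min (ltW a0) divr_ge0 ?addr_ge0 // ltW.
have := compression_exponent_ge infW (mulr_ge0 (ltW th0) m0) FL Fc.
rewrite -/q' mulrC -ler_pdivlMr // -/q leNgt => /negP; apply.
rewrite lt_min qa ltr_pdivlMr ?addr_gt0 //=.
by move: qb; rewrite ltr_pdivrMr ?subr_gt0 //; lra.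
Qed.
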